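(* There exist absolute constants $C,c_1,c_2\in(0,\infty)$ such that the following holds. Let $1\le p\le\infty$ and let $\sigma_1\ge\sigma_2\ge\cdots>0$ be a non-increasing sequence of positive reals. Then for all $m\in\mathbb{N}$ and $1\le n<m$, with probability at least $1-c_1\exp(-c_2 n)$, \[ \mathrm{rad}(\mathcal{E}_{p,\sigma}^m,E_n^{\mathrm{ran}})\le C\begin{cases} n^{-1/2}\sup\limits_{k\le j\le m}\sigma_j\sqrt{\log(j)+1} & \text{if } p=1,\\ \sqrt{p^*}\,n^{-1/2}\Big(\sum\limits_{j=k}^m\sigma_j^{p^*}\Big)^{1/p^*} & \text{if } 1<p\le\infty,\end{cases} \] where $k=k(n)$ are suitable positive integers with $k(n)\asymp n$ if $p=1$ and $k(n)\asymp n/p^*$ if $p>1$.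
   Context: $p^*$ is the Hölder conjugate of $p$, i.e. $\frac1p+\frac1{p^*}=1$. For $0<p\le\infty$ and $\sigma_1\ge\cdots\ge\sigma_m>0$, the $m$-dimensional $\ell_p$-ellipsoid is $\mathcal{E}_{p,\sigma}^m=\{x\in\mathbb{R}^m:\sum_{i=1}^m |x_i|^p/\sigma_i^p\le 1\}$ (with the sum of $p$-th powers replaced by $\max_i |x_i|/\sigma_i$ if $p=\infty$). For $K\subset\mathbb{R}^m$ and a linear subspace $E\subset\mathbb{R}^m$, $\mathrm{rad}(K,E)=\sup_{x\in K\cap E}\|x\|_2$. $E_n^{\mathrm{ran}}$ is a random linear subspace of $\mathbb{R}^m$ of codimension $n$, distributed according to the rotation invariant probability measure on the Grassmannian of $(m-n)$-dimensional subspaces; equivalently, $E_n^{\mathrm{ran}}=\ker G_{n,m}$ where $G_{n,m}$ is an $n\times m$ matrix with independent standard Gaussian entries. $\log$ is the natural logarithm. For non-negative sequences, $a_n\asymp b_n$ means that there are constants $c,C'>0$, independent of $n$ (and $m$), with $c\,b_n\le a_n\le C' b_n$ for all $n$. *)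

(* Defs.v *)
From HB Require Import structures.
From mathcomp Require Import all_boot all_order all_algebra.
From mathcomp Require Import all_classical all_reals all_analysis.
Import Order.TTheory GRing.Theory Num.Theory.
Import numFieldNormedType.Exports.

Set Implicit Arguments.
Unset Strict Implicit.
Unset Printing Implicit Defensive.

Local Open Scope classical_set_scope.
Local Open Scope ring_scope.

(* Sequences sigma : nat -> R are indexed from 1, so the coordinate i : 'I_m of
   a vector is weighted by sigma i.+1; sigma 0 is never used. *)

Section Ellipsoids.
Context {R : realType}.

(* The library norm on matrices is the sup norm. *)
Definition norm2 m (x : 'cV[R]_m) : R := Num.sqrt (\sum_(i < m) x i 0 ^+ 2).

(* Meant for 0 < p <= +oo. *)
Definition ellipsoid (p : \bar R) (sigma : nat -> R) (m : nat) :
    set 'cV[R]_m :=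
  if p == +oo%E then
    [set x | \big[Num.max/0]_(i < m) (`|x i 0| / sigma i.+1) <= 1]
  else
    [set x | \sum_(i < m) (`|x i 0| `^ fine p / sigma i.+1 `^ fine p) <= 1].

Definition section_rad m (K E : set 'cV[R]_m) : \bar R :=
  ereal_sup [set (norm2 x)%:E | x in K `&` E].

Definition ker_mx n m (A : 'M[R]_(n, m)) : set 'cV[R]_m :=
  [set x | A *m x = 0].

(* The real number p^* for 1 < p <= +oo; the value at p = 1, where p^* = +oo,
   is junk and not used. *)
Definition conj_exp (p : \bar R) : R := fine (hoelder_conjugate p).

Definition k_scale (p : \bar R) (n : nat) : R :=
  if p == 1%E then n%:R else n%:R / conj_exp p.

(* a n ≍ b n, with explicit constants *)
Definition asymp_with (c C' : R) (a b : nat -> R) : Prop :=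
  forall n, (1 <= n)%N -> c * b n <= a n <= C' * b n.

(* Maximum and sum over k <= j <= m. All terms are nonnegative, so the base
   value 0 of the maximum is harmless. *)
Definition rad_bound (p : \bar R) (sigma : nat -> R) (n m k : nat) : R :=
  if p == 1%E then
    n%:R `^ (- 2^-1) *
    \big[Num.max/0]_(k <= j < m.+1) (sigma j * Num.sqrt (ln j%:R + 1))
  else
    Num.sqrt (conj_exp p) * n%:R `^ (- 2^-1) *
    (\sum_(k <= j < m.+1) sigma j `^ conj_exp p) `^ (conj_exp p)^-1.

End Ellipsoids.

Arguments ellipsoid {R} p sigma m _.

Section GaussianMatrices.
Context {d : measure_display} {T : measurableType d} {R : realType}.
Variable P : probability T R.

Definition mutually_independent (I : finType) (X : I -> {RV P >-> R}) : Prop :=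
  forall (J : {set I}) (B : I -> set R), (forall i, measurable (B i)) ->
    P (\bigcap_(i in [set` J]) (X i @^-1` B i)) =
    (\prod_(i in J) P (X i @^-1` B i))%E.

Definition std_gaussian (X : {RV P >-> R}) : Prop :=
  forall A : set R, measurable A -> distribution P X A = normal_prob 0 1 A.

Definition std_gaussian_matrix n m (G : 'I_n -> 'I_m -> {RV P >-> R}) : Prop :=
  (forall i j, std_gaussian (G i j)) /\
  mutually_independent (fun ij : 'I_n * 'I_m => G ij.1 ij.2).

(* A random subspace of codimension n (almost surely), uniformly distributed
   when G is a standard Gaussian matrix and n < m. *)
Definition ran_subspace n m (G : 'I_n -> 'I_m -> {RV P >-> R}) (w : T) :
    set 'cV[R]_m :=
  ker_mx (\matrix_(i < n, j < m) G i j w).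

End GaussianMatrices.

(* Main.v *)
Require Import Defs.
From HB Require Import structures.
From mathcomp Require Import all_boot all_order all_algebra.
From mathcomp Require Import all_classical all_reals all_analysis.
From mathcomp Require Import measurable_realfun.
From mathcomp Require Import ring lra.
Import Order.TTheory GRing.Theory Num.Theory.
Import numFieldNormedType.Exports.

Set Implicit Arguments.
Unset Strict Implicit.
Unset Printing Implicit Defensive.

Local Open Scope classical_set_scope.
Local Open Scope ring_scope.

(** Let [x] be a vector of the ellipsoid with [G x = 0], shrunk to norm at most
    [r], where [r] is the radius to be established. Its coordinates are split into
    a head, the first [h = k n - 1] ones, about which only [|x| <= r] is known, and
    a tail. The proof combines Maurey sampling with a change of measure.

    The vector [x] is the barycenter of a probability on the points [0] and
    [+- t i e_i], for suitable steps [t i]. The mean [th] of [n] independent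
    samples satisfies [|th - x| ^ 2 = O(V / n)] and [|G (th - x)| ^ 2 = O(V)], [V]
    being the variance of one sample. On the other side,
    [E exp (- lam |G th| ^ 2) = (1 + 2 lam |th| ^ 2) ^ (- n / 2)] for a fixed [th],
    so that, for a prior law of the samples that does not depend on [x], the prior
    mean of [exp (- lam |G th| ^ 2) (1 + 2 lam |th| ^ 2) ^ (n / 2)] is at most
    [exp n] outside an event of probability [exp (- n)] ([good_event]). If the law
    of the samples of [x] has bounded relative entropy with respect to the prior,
    replacing one by the other costs a factor [exp (O(n))]; choosing [lam] large
    then produces a [th] close to [x] with [|G th| >= c sqrt n |th|]. Since
    [G x = 0], this forces [|x| ^ 2 = O(V / n)] ([maurey_lower_bound],
    [sparse_lower_bound]). One event serves all [x] at once: the entropy takes the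
    place of the cardinality of a net.

    It remains to choose steps and priors for which [V] has the right size.
    - The head is sampled uniformly with variance [2 h r ^ 2]; as [h] is a small
      multiple of [n], its contribution [O(h r ^ 2 / n)] to [|x| ^ 2] is absorbed
      ([kernel_radius]).
    - For [1 < p], with [q] the conjugate exponent and [W] the [l_q] norm of the
      tail of [sigma], the prior is proportional to [sigma j ^ q] and the step is a
      multiple of [q W], so that [V] is of order [q W ^ 2]. The entropy is bounded
      through [z ln z <= z ^ p / (p - 1)], which is where the factor [sqrt p^*]
      comes from ([ellipsoid_tail], [entropy_radius]).
    - For [p = 1] the prior is of order [1 / j ^ 2] and the step is a multiple of
      [sigma j (1 + ln j)]. Coordinates with [1 + ln j > n] are too expensive; they
      are left out, and [sigma j <= M / sqrt n] makes them harmless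
      ([weighted_l1_radius]).

    The probabilistic input is the Laplace transform of a sum of squared Gaussian
    linear forms ([gaussian_forms_laplace]), computed by integrating out one
    entry at a time. The radius event is measurable by [measurable_kernel_radius]. *)

(** * Sampling from a finite set *)

Section Sampling.
Context {R : realType} {A : finType}.
Implicit Types (w rho prior : A -> R) (F : seq A -> R).

(** Mean of [F] over [n] independent draws with weights [w]. Drawing one point at a
    time makes every property below an induction on [n]. *)
Fixpoint iid_mean w n F : R :=
  if n is n'.+1 then \sum_a w a * iid_mean w n' (fun s => F (a :: s)) else F [::].

Lemma eq_iid_mean w n F1 F2 : (forall s, size s = n -> F1 s = F2 s) ->
  iid_mean w n F1 = iid_mean w n F2.
Proof.
elim: n F1 F2 => [|n IH] F1 F2 eF /=; first exact: eF.
by apply: eq_bigr => a _; congr (_ * _); apply: IH => s sn; apply: eF => /=; rewrite sn.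
Qed.

Arguments eq_iid_mean {w n F1} F2.

Lemma le_iid_mean w n F1 F2 : (forall a, 0 <= w a) ->
  (forall s, size s = n -> F1 s <= F2 s) -> iid_mean w n F1 <= iid_mean w n F2.
Proof.
move=> w0; elim: n F1 F2 => [|n IH] F1 F2 leF /=; first exact: leF.
apply: ler_sum => a _; apply: ler_wpM2l => //.
by apply: IH => s sn; apply: leF => /=; rewrite sn.
Qed.

Lemma iid_meanD w n F1 F2 : iid_mean w n (fun s => F1 s + F2 s) = iid_mean w n F1 + iid_mean w n F2.
Proof.
elim: n F1 F2 => [//|n IH] F1 F2 /=.
by rewrite -big_split /=; apply: eq_bigr => a _; rewrite IH mulrDr.
Qed.

Lemma iid_meanZ w n c F : iid_mean w n (fun s => c * F s) = c * iid_mean w n F.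
Proof.
elim: n F => [//|n IH] F /=.
by rewrite mulr_sumr; apply: eq_bigr => a _; rewrite IH mulrCA.
Qed.

Lemma iid_mean_cst w n c : iid_mean w n (fun=> c) = (\sum_a w a) ^+ n * c.
Proof.
elim: n => [|n IH] /=; first by rewrite expr0 mul1r.
by rewrite IH -mulr_suml exprS mulrA.
Qed.

Lemma iid_mean_sum w n (I : finType) (F : I -> seq A -> R) :
  iid_mean w n (fun s => \sum_i F i s) = \sum_i iid_mean w n (F i).
Proof.
elim: n F => [//|n IH] F /=.
rewrite exchange_big /=; apply: eq_bigr => a _.
by rewrite IH mulr_sumr.
Qed.

(** Two laws are compared draw by draw once their weights are moved inside. *)
Lemma iid_mean_weights w n F :
  iid_mean w n F = iid_mean (fun=> 1) n (fun s => \prod_(a <- s) w a * F s).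
Proof.
elim: n F => [|n IH] F /=; first by rewrite big_nil mul1r.
apply: eq_bigr => a _; rewrite mul1r IH -iid_meanZ; apply: eq_iid_mean => s _.
by rewrite big_cons mulrA.
Qed.

Lemma iid_mean_additive rho n (l : A -> R) : \sum_a rho a = 1 ->
  iid_mean rho n (fun s => \sum_(a <- s) l a) = n%:R * \sum_a rho a * l a.
Proof.
move=> rho1; elim: n => [|n IH] /=; first by rewrite big_nil mul0r.
under eq_bigr => a _.
  rewrite (eq_iid_mean (fun s => l a + \sum_(b <- s) l b)); last first.
    by move=> s _; rewrite big_cons.
  rewrite iid_meanD iid_mean_cst rho1 expr1n mul1r IH mulrDr; over.
by rewrite big_split /= -mulr_suml rho1 mul1r -[n.+1]addn1 natrD mulrDl mul1r addrC.
Qed.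

(** Centered draws are uncorrelated, so only the diagonal terms of the square
    survive. *)
Lemma iid_mean_centered_sqr rho n (Z : A -> R) (c : R) :
  \sum_a rho a = 1 -> \sum_a rho a * Z a = 0 ->
  iid_mean rho n (fun s => (c + \sum_(a <- s) Z a) ^+ 2) =
  c ^+ 2 + n%:R * \sum_a rho a * Z a ^+ 2.
Proof.
move=> rho1 Z0; elim: n c => [|n IH] c /=; first by rewrite big_nil mul0r !addr0.
transitivity (\sum_a (rho a * (c ^+ 2 + n%:R * \sum_b rho b * Z b ^+ 2) +
     (2 * c) * (rho a * Z a) + rho a * Z a ^+ 2)).
  apply: eq_bigr => a _.
  rewrite (eq_iid_mean (fun s => (c + Z a + \sum_(b <- s) Z b) ^+ 2)).
    by rewrite IH; ring.
  by move=> s _; rewrite big_cons addrA.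
rewrite !big_split /= -mulr_suml rho1 mul1r -mulr_sumr Z0 mulr0 addr0.
by rewrite -[n.+1]addn1 natrD mulrDl mul1r addrA.
Qed.

(** Markov's inequality; a mean of [3] is that of a sum of three terms of mean at
    most one. *)
Lemma iid_mean_markov rho n F : (forall a, 0 <= rho a) -> \sum_a rho a = 1 ->
  (forall s, 0 <= F s) -> iid_mean rho n F <= 3 ->
  4^-1 <= iid_mean rho n (fun s => if F s <= 4 then 1 else 0).
Proof.
move=> rho0 rho1 F0 F3.
have : iid_mean rho n (fun s => 4 * 1 + (- 4) * (if F s <= 4 then 1 else 0)) <= 3.
  apply: le_trans F3; apply: le_iid_mean => // s _.
  case: ifPn => h; first by have := F0 s; lra.
  by rewrite mulr0 mulr1 addr0 ltW// ltNge.
rewrite iid_meanD 2!iid_meanZ iid_mean_cst rho1 expr1n; lra.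
Qed.

End Sampling.
Arguments eq_iid_mean {R A w n F1} F2.

(** * Empirical approximation of a barycenter *)

Section SquaredNorm.
Context {R : realType}.

Definition sqn m (x : 'cV[R]_m) : R := \sum_i x i 0 ^+ 2.

Lemma sqn_ge0 m (x : 'cV[R]_m) : 0 <= sqn x.
Proof. by apply: sumr_ge0 => i _; exact: sqr_ge0. Qed.

Lemma sqnZ m (c : R) (x : 'cV[R]_m) : sqn (c *: x) = c ^+ 2 * sqn x.
Proof.
by rewrite /sqn mulr_sumr; apply: eq_bigr => i _; rewrite mxE exprMn.
Qed.

Lemma sqn_split m (x y : 'cV[R]_m) : sqn x <= 2 * sqn (x - y) + 2 * sqn y.
Proof.
rewrite /sqn !mulr_sumr -big_split /=; apply: ler_sum => i _; rewrite !mxE.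
have := sqr_ge0 (x i 0 - 2 * y i 0); nra.
Qed.

Lemma sqn0 m : sqn (0 : 'cV[R]_m) = 0.
Proof. by rewrite /sqn big1// => i _; rewrite mxE expr0n. Qed.

Lemma sqn_delta m j : sqn (delta_mx j 0 : 'cV[R]_m) = 1.
Proof.
rewrite /sqn (bigD1 j)//= !mxE !eqxx expr1n big1 ?addr0// => i ij.
by rewrite mxE (negbTE ij) expr0n.
Qed.

Lemma norm2_le m (x : 'cV[R]_m) (c : R) : 0 <= c -> (norm2 x <= c) = (sqn x <= c ^+ 2).
Proof.
by move=> c0; rewrite /norm2 -{1}(ger0_norm c0) -sqrtr_sqr ler_sqrt ?sqr_ge0.
Qed.

End SquaredNorm.

Section Maurey.
Context {R : realType} {A : finType}.

Definition empirical n m (v : A -> 'cV[R]_m) (s : seq A) : 'cV[R]_m :=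
  n%:R^-1 *: \sum_(a <- s) v a.

(** The sampled points are independent, so the variances add up and the factor
    [n^-2] of the empirical mean leaves a single [n^-1]. *)
Lemma empirical_variance n m (rho : A -> R) (v : A -> 'cV[R]_m) (y : 'cV[R]_m) :
  (0 < n)%N -> (forall a, 0 <= rho a) -> \sum_a rho a = 1 ->
  y = \sum_a rho a *: v a ->
  iid_mean rho n (fun s => sqn (empirical n v s - y)) <=
  n%:R^-1 * \sum_a rho a * sqn (v a).
Proof.
move=> n0 rho0 rho1 yE.
have nR0 : n%:R != 0 :> R by rewrite pnatr_eq0 -lt0n.
have yi i : y i 0 = \sum_a rho a * v a i 0.
  by rewrite yE summxE; apply: eq_bigr => a _; rewrite mxE.
rewrite iid_mean_sum /sqn (eq_bigr (fun a => \sum_i rho a * v a i 0 ^+ 2)); last first.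
  by move=> a _; rewrite mulr_sumr.
rewrite exchange_big /= mulr_sumr; apply: ler_sum => i _.
pose Z a := v a i 0 - y i 0.
have Z0 : \sum_a rho a * Z a = 0.
  rewrite (eq_bigr (fun a => rho a * v a i 0 - rho a * y i 0)); last first.
    by move=> a _; rewrite mulrBr.
  by rewrite sumrB -mulr_suml rho1 mul1r yi subrr.
rewrite (eq_iid_mean (fun s : seq A => n%:R ^- 2 * (0 + \sum_(a <- s) Z a) ^+ 2)); last first.
  move=> s sn; rewrite !mxE summxE add0r /Z big_split /= big_const_seq count_predT sn.
  rewrite iter_addr addr0 -mulr_natr.
  by field.
rewrite iid_meanZ iid_mean_centered_sqr// expr0n /= add0r.
rewrite (_ : n%:R ^- 2 * _ = n%:R^-1 * \sum_a rho a * Z a ^+ 2); last by field.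
rewrite ler_pM2l ?invr_gt0 ?ltr0n//.
have -> : \sum_a rho a * Z a ^+ 2 = \sum_a rho a * v a i 0 ^+ 2 - y i 0 ^+ 2.
  rewrite (eq_bigr (fun a => rho a * v a i 0 ^+ 2 + (- 2 * y i 0 * (rho a * v a i 0)
     + y i 0 ^+ 2 * rho a))); last by move=> a _; rewrite /Z; ring.
  rewrite !big_split /= -!mulr_sumr -yi rho1; ring.
by rewrite lerBlDr lerDl sqr_ge0.
Qed.

(** The second factor normalizes the Laplace transform: for a standard Gaussian
    matrix [G] the mean of this weight is [1], whatever [x]. *)
Definition laplace_weight n m (lam : R) (G : 'M[R]_(n, m)) (x : 'cV[R]_m) : R :=
  expR (- (lam * sqn (G *m x))) * Num.sqrt (1 + 2 * lam * sqn x) ^+ n.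

Lemma laplace_weight_ge0 n m (lam : R) (G : 'M[R]_(n, m)) (x : 'cV[R]_m) :
  0 <= laplace_weight lam G x.
Proof. by rewrite mulr_ge0 ?expR_ge0// exprn_ge0// sqrtr_ge0. Qed.

Lemma prod_le_expR_sum (w rho l : A -> R) (s : seq A) :
  (forall a, 0 <= rho a) -> (forall a, 0 <= w a) ->
  (forall a, rho a <= expR (l a) * w a) ->
  \prod_(a <- s) rho a <= expR (\sum_(a <- s) l a) * \prod_(a <- s) w a.
Proof.
move=> rho0 w0 rhow; elim: s => [|a s IH]; first by rewrite !big_nil expR0 mul1r.
rewrite !big_cons expRD mulrACA; apply: ler_pM => //.
by elim/big_ind : _ => // x y x0 y0; exact: mulr_ge0.
Qed.

(** A lower bound [Q = sampling_level H] on [sqrt (1 + 2 lam |th| ^ 2)] gives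
    [Q ^ n = 8 ^ n exp ((4 H + 2) n)]. The exponential pays for the change of
    measure, the exponent [lam |G th| ^ 2 <= n] and the bound [exp n] on the prior
    mean; the factor [8 ^ n] beats the probability [1/4] of the good samples. *)
Definition sampling_level (H : R) : R := 8 * expR (4 * H + 2).

(** With probability [1/4] under [rho], an [n]-sample is simultaneously close to [y],
    close to [G y] after applying [G], and of likelihood ratio at most
    [exp (4 H n)]. If [|G y|] were small and [|y|] large, every such sample would
    have a huge weight [laplace_weight]; the prior mean of this weight would then
    exceed [exp n]. *)
Lemma maurey_lower_bound n m (G : 'M[R]_(n, m)) (prior rho l : A -> R)
    (v : A -> 'cV[R]_m) (y : 'cV[R]_m) (H D B V : R) :
  (0 < n)%N -> 0 < H -> 0 < D -> 0 < B -> 0 < V ->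
  (forall a, 0 <= prior a) -> (forall a, 0 <= rho a) -> \sum_a rho a = 1 ->
  (forall a, 0 <= l a) -> (forall a, rho a <= expR (l a) * prior a) ->
  \sum_a rho a * l a <= H ->
  y = \sum_a rho a *: v a ->
  \sum_a rho a * sqn (v a) <= V ->
  \sum_a rho a * sqn (G *m v a) <= n%:R * (D * V) ->
  iid_mean prior n (fun s => laplace_weight (n%:R / ((2 * B + 8 * D) * V)) G (empirical n v s))
    <= expR n%:R ->
  sqn (G *m y) <= B * V ->
  sqn y < (8 + (2 * B + 8 * D) * sampling_level H ^+ 2) * V / n%:R.
Proof.
move=> n0 H0 D0 B0 V0 prior0 rho0 rho1 l0 rhol lH yE vV GV Psi GyB.
set E := 2 * B + 8 * D; set Q := sampling_level H; set lam := n%:R / (E * V).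
have nR0 : 0 < n%:R :> R by rewrite ltr0n.
have E0 : 0 < E by rewrite /E; lra.
have Q0 : 0 < Q by rewrite /Q /sampling_level mulr_gt0 ?expR_gt0.
have lam0 : 0 < lam by rewrite divr_gt0// mulr_gt0.
rewrite ltNge; apply/negP => yC.
pose th := empirical n v.
(* Each of the three terms is nonnegative with mean at most one under [rho]. *)
pose T s := (n%:R * H)^-1 * \sum_(a <- s) l a + (n%:R / V * sqn (th s - y)
  + (D * V)^-1 * sqn (G *m th s - G *m y)).
have GthE s : G *m th s = empirical n (fun a => G *m v a) s.
  by rewrite /th /empirical -scalemxAr mulmx_sumr.
have T0 s : 0 <= T s.
  apply: addr_ge0; first by rewrite mulr_ge0 ?invr_ge0 ?sumr_ge0// ltW// mulr_gt0.
  apply: addr_ge0; first by rewrite mulr_ge0 ?sqn_ge0// divr_ge0 ?ltW.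
  by rewrite mulr_ge0 ?sqn_ge0// invr_ge0 ltW// mulr_gt0.
have ET : iid_mean rho n T <= 3.
  rewrite /T !iid_meanD !iid_meanZ iid_mean_additive//.
  have h1 : (n%:R * H)^-1 * (n%:R * \sum_a rho a * l a) <= 1.
    by rewrite mulrC ler_pdivrMr ?mulr_gt0// mul1r ler_pM2l.
  have h2 : n%:R / V * iid_mean rho n (fun s => sqn (th s - y)) <= 1.
    have := empirical_variance n0 rho0 rho1 yE.
    move=> /(ler_wpM2l (_ : 0 <= n%:R / V)) h; apply: (le_trans (h _)).
      by rewrite divr_ge0 ?ltW.
    rewrite mulrA (_ : n%:R / V / n%:R = V^-1); last by field; lra.
    by rewrite mulrC ler_pdivrMr// mul1r.
  have h3 : (D * V)^-1 * iid_mean rho n (fun s => sqn (G *m th s - G *m y)) <= 1.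
    rewrite mulrC ler_pdivrMr ?mulr_gt0// mul1r.
    rewrite (eq_iid_mean (fun s : seq A => sqn (empirical n (fun a => G *m v a) s - G *m y))); last first.
      by move=> s _; rewrite GthE.
    apply: (le_trans (empirical_variance n0 rho0 rho1 _)).
      by rewrite yE mulmx_sumr; apply: eq_bigr => a _; rewrite scalemxAr.
    by rewrite mulrC ler_pdivrMr// mulrC.
  by lra.
have := iid_mean_markov rho0 rho1 T0 ET.
rewrite iid_mean_weights.
set K := expR (4 * H * n%:R) * (expR n%:R / Q ^+ n).
have K0 : 0 <= K by rewrite mulr_ge0 ?expR_ge0// divr_ge0 ?expR_ge0// exprn_ge0// ltW.
have prior_prod0 (s : seq A) : 0 <= \prod_(a <- s) prior a.
  by elim/big_ind : _ => // x y' x0 y0; exact: mulr_ge0.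
have : iid_mean (fun=> 1) n (fun s => \prod_(a <- s) rho a * (if T s <= 4 then 1 else 0)) <=
       K * iid_mean prior n (fun s => laplace_weight lam G (th s)).
  rewrite -iid_meanZ [leRHS]iid_mean_weights; apply: le_iid_mean => // s sn.
  case: ifPn => [T4|_]; last first.
    rewrite mulr0; apply: mulr_ge0 => //; apply: mulr_ge0 => //.
    exact: laplace_weight_ge0.
  rewrite mulr1.
  have t1 : 0 <= (n%:R * H)^-1 * \sum_(a <- s) l a.
    by rewrite mulr_ge0 ?invr_ge0 ?sumr_ge0// ltW// mulr_gt0.
  have t2 : 0 <= n%:R / V * sqn (th s - y) by rewrite mulr_ge0 ?sqn_ge0// divr_ge0 ?ltW.
  have t3 : 0 <= (D * V)^-1 * sqn (G *m th s - G *m y).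
    by rewrite mulr_ge0 ?sqn_ge0// invr_ge0 ltW// mulr_gt0.
  have {t1 t2 t3}[e1 e2 e3] : [/\ \sum_(a <- s) l a <= 4 * H * n%:R,
     sqn (th s - y) <= 4 * V / n%:R & sqn (G *m th s - G *m y) <= 4 * (D * V)].
    rewrite /T in T4; split.
    - have : (n%:R * H)^-1 * \sum_(a <- s) l a <= 4 by lra.
      by rewrite mulrC ler_pdivrMr ?mulr_gt0// -mulrA [n%:R * H]mulrC.
    - have : n%:R / V * sqn (th s - y) <= 4 by lra.
      by rewrite mulrAC ler_pdivrMr// mulrC -ler_pdivlMr.
    - have : (D * V)^-1 * sqn (G *m th s - G *m y) <= 4 by lra.
      by rewrite mulrC ler_pdivrMr ?mulr_gt0.
  have f1 : sqn (G *m th s) <= E * V.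
    apply: (le_trans (sqn_split _ (G *m y))); rewrite /E; lra.
  have f2 : E * Q ^+ 2 / 2 * V / n%:R <= sqn (th s).
    have := sqn_split y (th s).
    have -> : sqn (y - th s) = sqn (th s - y).
      by rewrite -opprB -scaleN1r sqnZ sqrrN expr1n mul1r.
    rewrite (_ : (8 + E * Q ^+ 2) * V / n%:R =
      2 * (4 * V / n%:R) + 2 * (E * Q ^+ 2 / 2 * V / n%:R)) in yC; last by field; lra.
    lra.
  have f3 : expR (- n%:R) * Q ^+ n <= laplace_weight lam G (th s).
    apply: ler_pM; rewrite ?expR_ge0 ?exprn_ge0 ?(ltW Q0)//.
      rewrite ler_expR lerN2 /lam mulrAC ler_pdivrMr ?mulr_gt0//.
      by rewrite ler_pM2l.
    apply: lerXn2r; rewrite ?nnegrE ?sqrtr_ge0 ?(ltW Q0)//.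
    rewrite -(ger0_norm (ltW Q0)) -sqrtr_sqr ler_sqrt; last first.
      by rewrite addr_ge0// mulr_ge0 ?sqn_ge0// mulr_ge0// ltW.
    have : 2 * lam * (E * Q ^+ 2 / 2 * V / n%:R) <= 2 * lam * sqn (th s).
      by rewrite ler_pM2l// mulr_gt0.
    rewrite (_ : 2 * lam * (E * Q ^+ 2 / 2 * V / n%:R) = Q ^+ 2); first by lra.
    rewrite /lam; field; lra.
  apply: (le_trans (prod_le_expR_sum s rho0 prior0 rhol)).
  rewrite mulrC ler_wpM2l//.
  apply: (@le_trans _ _ (expR (4 * H * n%:R))); first by rewrite ler_expR.
  rewrite /K -[leRHS]mulrA ler_peMr ?expR_ge0// mulrAC ler_pdivlMr ?exprn_gt0// mul1r.
  rewrite -(ler_pM2l (expR_gt0 n%:R)) expRN in f3.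
  by rewrite mulrA divff ?mul1r ?gt_eqF ?expR_gt0 in f3.
move=> le1 le2.
have : 4^-1 <= K * expR n%:R.
  by apply: (le_trans le2); apply: (le_trans le1); rewrite ler_wpM2l.
(* The comparison of means now reads [1/4 <= 8 ^ (- n)]. *)
have -> : K * expR n%:R = 8 ^- n.
  have -> : K = expR (4 * H * n%:R) * (expR n%:R /
      (8 ^+ n * (expR (4 * H * n%:R) * (expR n%:R * expR n%:R)))).
    rewrite /K /Q /sampling_level exprMn -expRM_natl -!expRD.
    by rewrite (_ : n%:R * (4 * H + 2) = 4 * H * n%:R + (n%:R + n%:R)) //; ring.
  have h1 := expR_gt0 (4 * H * n%:R); have h2 := expR_gt0 (n%:R : R).
  have h3 : 8 ^+ n != 0 :> R by rewrite expf_neq0.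
  by field; rewrite h3 !gt_eqF.
case: n n0 {nR0 Psi lam lam0 th T GthE T0 ET K K0 le1 le2 GV GyB yC G} => // n _.
rewrite exprS => h.
have : 1 <= 8 ^+ n :> R by rewrite exprn_ege1// ler1n.
move: h; rewrite lef_pV2 ?posrE ?mulr_gt0 ?exprn_gt0//; lra.
Qed.

End Maurey.

(** * Gaussian integrals *)

Section Density.
Context d (T : measurableType d) (R : realType).
Variables (mu nu : {measure set T -> \bar R}) (h : T -> R).
Import HBNNSimple.
Local Open Scope ereal_scope.
Hypotheses (mh : measurable_fun setT h) (h0 : forall x, (0 <= h x)%R)
  (nuE : forall A, measurable A -> nu A = \int[mu]_(x in A) (h x)%:E).

(** True for indicators by hypothesis; simple functions and monotone limits do the
    rest. *)
Lemma ge0_integral_density (f : T -> \bar R) :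
  measurable_fun setT f -> (forall x, 0 <= f x) ->
  \int[nu]_x f x = \int[mu]_x (f x * (h x)%:E).
Proof.
move=> mf f0; have mEh : measurable_fun setT (EFin \o h) by exact/measurable_EFinP.
pose g := nnsfun_approx measurableT mf.
have mg n : measurable_fun setT (EFin \o g n).
  by apply/measurable_EFinP; exact: (measurable_funP (g n)).
have mgk n k : measurable_fun setT (EFin \o \1_(g n @^-1` [set k])).
  by apply/measurable_EFinP; exact: measurable_indic.
have gf x : (EFin \o g n) x @[n --> \oo] --> f x.
  by apply: cvg_nnsfun_approx => // *; exact: f0.
have ndg x : {homo (fun n => (EFin \o g n) x) : a b / (a <= b)%N >-> a <= b}.
  by move=> a b ab; rewrite lee_fin; exact/lefP/nd_nnsfun_approx.
transitivity (limn (fun n => \int[nu]_x (EFin \o g n) x)).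
  rewrite -monotone_convergence//.
  - by apply: eq_integral => x _; apply/esym/cvg_lim => //; exact: gf.
  - by move=> n x _; rewrite lee_fin.
transitivity (limn (fun n =>
    \int[mu]_x ((EFin \o g n) x * (h x)%:E))); last first.
  rewrite -monotone_convergence//.
  - apply: eq_integral => x _; apply/cvg_lim => //.
    by apply: cvgeZr => //; exact: gf.
  - by move=> n; apply: emeasurable_funM => //; exact: mg.
  - by move=> n x _; rewrite mule_ge0// lee_fin.
  - move=> x _ a b ab; apply: lee_wpmul2r; first by rewrite lee_fin.
    exact: (ndg x a b ab).
congr (limn _); apply/funext => n.
have -> : \int[nu]_x (EFin \o g n) x = sintegral nu (g n).
  by rewrite -integralT_nnsfun.
rewrite sintegralE.
transitivity (\int[mu]_x \sum_(k \in range (g n))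
   (k%:E * ((\1_(g n @^-1` [set k]) x)%:E * (h x)%:E))).
  rewrite ge0_integral_fsum//; last 2 first.
  - move=> k; apply: emeasurable_funM => //; apply: emeasurable_funM => //.
    exact: mgk.
  - move=> k x _; rewrite muleA; apply: mule_ge0; last by rewrite lee_fin.
    exact: nnfun_muleindic_ge0.
  apply: eq_fsbigr => k; rewrite inE => -[x _ <-].
  rewrite ge0_integralZl ?lee_fin//.
  - congr (_ * _); rewrite nuE// integral_mkcond; apply: eq_integral => y _.
    rewrite patchE indicE; case: ifPn => _; first by rewrite mul1e.
    by rewrite mul0e.
  - by apply: emeasurable_funM => //; exact: mgk.
  - by move=> y _; rewrite mule_ge0// lee_fin.
apply: eq_integral => x _ /=; rewrite fimfunE -fsumEFin//.
rewrite ge0_mule_fsuml//; last first.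
  by move=> k; rewrite EFinM; exact: nnfun_muleindic_ge0.
by apply: eq_fsbigr => k _; rewrite EFinM muleA.
Qed.

End Density.

Section NormalIntegral.
Context {R : realType}.

Lemma ge0_integral_normal_prob (m s : R) (f : R -> \bar R) :
  measurable_fun [set: R] f -> (forall x, 0 <= f x)%E ->
  (\int[normal_prob m s]_x f x =
  \int[lebesgue_measure]_x (f x * (normal_pdf m s x)%:E))%E.
Proof.
move=> mf f0; apply: ge0_integral_density => //.
- exact: measurable_normal_pdf.
- by move=> x; rewrite normal_pdf_ge0.
Qed.

(** Completing the square: [- lam (s + t y) ^ 2 - y ^ 2 / 2] is a Gaussian
    exponent in [y] of variance [1 / c], [c = 1 + 2 lam t ^ 2]. *)
Lemma integral_normal_expR_sqr (lam s t : R) : 0 < 1 + 2 * lam * t ^+ 2 ->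
  (\int[normal_prob 0 1]_y (expR (- (lam * (s + t * y) ^+ 2)))%:E =
  ((Num.sqrt (1 + 2 * lam * t ^+ 2))^-1 *
     expR (- (lam / (1 + 2 * lam * t ^+ 2) * s ^+ 2)))%:E)%E.
Proof.
set c := 1 + _ => c0.
have mf : measurable_fun [set: R] (fun y => (expR (- (lam * (s + t * y) ^+ 2)))%:E).
  apply/measurable_EFinP; apply: measurableT_comp => //.
  apply: measurableT_comp => //; apply: measurable_funM => //.
  by apply: measurable_funX; apply: measurable_funD => //; exact: measurable_funM.
rewrite ge0_integral_normal_prob//.
set K := _ * expR _.
have sc0 : 0 < Num.sqrt c by rewrite sqrtr_gt0.
have K0 : 0 <= K by rewrite mulr_ge0 ?expR_ge0// invr_ge0 ltW.
pose m' := - (2 * lam * s * t / c); pose s' := (Num.sqrt c)^-1.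
have s'0 : s' != 0 by rewrite invr_neq0// gt_eqF.
transitivity (\int[lebesgue_measure]_y (K%:E * (normal_pdf m' s' y)%:E))%E; last first.
  rewrite ge0_integralZl_EFin ?integral_normal_pdf ?mule1//.
  - by move=> x _; rewrite lee_fin normal_pdf_ge0.
  - by apply/measurable_EFinP; exact: measurable_normal_pdf.
apply: eq_integral => y _; rewrite -!EFinM; congr (_%:E).
rewrite !normal_pdfE ?oner_neq0// /normal_peak /normal_fun.
have s'2 : s' ^+ 2 = c^-1 by rewrite exprVn sqr_sqrtr// ltW.
rewrite s'2 expr1n mul1r subr0.
have -> : Num.sqrt (c^-1 * pi *+ 2) = Num.sqrt (pi *+ 2) / Num.sqrt c.
  by rewrite -mulrnAr sqrtrM ?invr_ge0 ?(ltW c0)// sqrtrV ?(ltW c0)// mulrC.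
have p0 : 0 < Num.sqrt (pi *+ 2 : R) by rewrite sqrtr_gt0 mulrn_wgt0// pi_gt0.
rewrite mulrCA -expRD /K.
rewrite [RHS](_ : _ = (Num.sqrt (pi *+ 2))^-1 *
  (expR (- (lam / c * s ^+ 2)) * expR (- (y - m') ^+ 2 / (c^-1 *+ 2)))); last first.
  by field; rewrite !gt_eqF.
congr (_ * _); rewrite -expRD; congr expR.
rewrite /m' /c; field.
by rewrite -/c gt_eqF.
Qed.

End NormalIntegral.

(** * Independent Gaussian families *)

Section Freezing.
Context {d : measure_display} {T : measurableType d} {R : realType}.
Variable P : probability T R.
Context {I : finType} (X : I -> {RV P >-> R}).

Implicit Types J : {set I}.

(** A pi-system generating the events that depend on the variables indexed by [J]
    only. *)
Definition cylinders (J : {set I}) : set (set T) :=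
  [set A | exists2 B : I -> set R, (forall i, measurable (B i)) &
     A = \bigcap_(i in [set` J]) (X i @^-1` B i)].

(** The underlying space with the sigma-algebra of the variables indexed by [J]:
    a function measurable for it is frozen when another variable is integrated. *)
Definition sub_space (J : {set I}) := g_sigma_algebraType (cylinders J).

Lemma cylinders_measurable J : cylinders J `<=` measurable.
Proof.
move=> _ [B mB ->]; apply: fin_bigcap_measurable => // i _.
by rewrite -[X in measurable X]setTI; exact: measurable_funP.
Qed.

Lemma cylindersI J : setI_closed (cylinders J).
Proof.
move=> _ _ [B mB ->] [C mC ->]; exists (fun i => B i `&` C i).
  by move=> i; exact: measurableI.
by rewrite -bigcapI; apply: eq_bigcapr => i _; rewrite preimage_setI.
Qed.

Lemma cylindersT J : cylinders J setT.
Proof.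
exists (fun=> setT) => //; by apply/esym/seteqP; split => // x _ i _.
Qed.

Lemma measurable_sub_space (J : {set I}) i : i \in J ->
  measurable_fun setT (X i : sub_space J -> R).
Proof.
move=> iJ _ B mB; rewrite setTI; apply: sub_sigma_algebra.
exists (fun j => if j == i then B else setT); first by move=> j; case: ifP.
apply/seteqP; split => [x Bx j _ /=|x /(_ i iJ) /=]; last by rewrite eqxx.
by case: eqP => [->|].
Qed.

Lemma measurable_id_sub_space J : measurable_fun setT (id : T -> sub_space J).
Proof.
apply: (@measurability _ _ T (sub_space J) setT id (cylinders J)) => //.
by move=> _ [A cA <-]; rewrite setTI preimage_id; exact: cylinders_measurable cA.
Qed.

Hypothesis indep : mutually_independent X.

(** Both sides are finite measures in [A], so agreement on cylinders is enough;
    there it is the product rule for [i |: J]. *)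
Lemma independent_sub_space (J : {set I}) i (A : set T) (B : set R) :
  i \notin J -> <<s cylinders J >> A -> measurable B ->
  P (A `&` X i @^-1` B) = (P A * P (X i @^-1` B))%E.
Proof.
move=> iJ sA mB.
have mXB : measurable (X i @^-1` B).
  by rewrite -[X in measurable X]setTI; exact: measurable_funP.
pose r : {nonneg R} := NngNum (fine_ge0 (measure_ge0 P (X i @^-1` B))).
suff : mrestr P mXB A = mscale r P A.
  rewrite /mrestr /mscale /= => ->.
  by rewrite fineK ?fin_num_measure// muleC.
apply: (g_sigma_algebra_measure_unique (cylinders J) _ (fun=> setT)) sA.
- exact: cylinders_measurable.
- by move=> _; exact: cylindersT.
- by rewrite bigcup_const//; exists 0%N.
- exact: cylindersI.
- move=> _ [C mC ->]; rewrite /= /mrestr /mscale /= fineK ?fin_num_measure//.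
  pose C' j := if j == i then B else C j.
  have mC' j : measurable (C' j) by rewrite /C'; case: ifP.
  have := indep (i |: J) mC'.
  rewrite big_setU1//= {2}/C' eqxx => E.
  transitivity (P (\bigcap_(j in [set` (i |: J)%SET]) (X j @^-1` C' j))).
    congr (P _); apply/seteqP; split=> [x [JC Bx] j /=|x h /=].
      rewrite !inE /C'; have [->//|_] := eqVneq j i.
      by move=> /= jJ; exact: JC.
    split; last by have := h i; rewrite /= !inE eqxx /C' eqxx; exact.
    move=> j /= jJ; have := h j; rewrite /= !inE jJ orbT /C'.
    by case: eqP jJ iJ => [-> ->//|_ _ _]; exact.
  rewrite E; congr (_ * _)%E.
  rewrite (indep J mC); apply: eq_bigr => j jJ.
  by rewrite /C'; case: eqP jJ iJ => [-> ->|].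
- by move=> _; rewrite /= /mrestr setTI (le_lt_trans (probability_le1 _ _)) ?ltry.
Qed.

(** Tonelli's theorem for the joint law of the frozen variables and [X i], which is a
    product measure by [independent_sub_space]. *)
Lemma freezing J i (N : probability (measurableTypeR R) R)
    (F : sub_space J * measurableTypeR R -> \bar R) :
  i \notin J -> (forall A : set R, measurable A -> P (X i @^-1` A) = N A) ->
  measurable_fun setT F -> (forall z, 0 <= F z)%E ->
  (\int[P]_w F (w, X i w) = \int[P]_w \int[N]_y F (w, y))%E.
Proof.
move=> iJ XN mF F0.
pose Z : {mfun T >-> sub_space J} := mfun_Sub (mem_set (@measurable_id_sub_space J)).
have mX : measurable_fun setT (X i : T -> measurableTypeR R).
  have mX0 : measurable_fun setT (X i : T -> R) by exact: measurable_funPT.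
  by move=> mT B mB; exact: (mX0 mT B mB).
have mW : measurable_fun setT
    ((fun w => (w, X i w)) : T -> sub_space J * measurableTypeR R).
  by apply: measurable_fun_pair => //; exact: measurable_id_sub_space.
pose W : {mfun T >-> (sub_space J * measurableTypeR R)%type} := mfun_Sub (mem_set mW).
transitivity (\int[distribution P W]_z F z)%E.
  by rewrite ge0_integral_distribution.
transitivity (\int[(distribution P Z \x N)%E]_z F z)%E.
  apply: eq_measure_integral => A mA _; apply/esym.
  apply: product_measure_unique => // B C mB mC.
  apply: (etrans (@independent_sub_space J i B C iJ mB mC)).
  by congr (_ * _)%E; exact: XN.
rewrite fubini_tonelli1// ge0_integral_distribution//.
- exact: measurable_fun_fubini_tonelli_F.
- by move=> w; apply: integral_ge0.
Qed.

End Freezing.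

Section GaussianForms.
Context {d : measure_display} {T : measurableType d} {R : realType}.
Variable P : probability T R.
Context {n m : nat} (G : 'I_n -> 'I_m -> {RV P >-> R}).
Hypothesis hG : std_gaussian_matrix G.

Let X (ij : 'I_n * 'I_m) := G ij.1 ij.2.

(** Freezing all entries but one, the integral over the remaining entry is
    one-dimensional; it removes this entry from the form of its row and replaces
    [lam i] by [lam i / (1 + 2 lam i a ^ 2)]. *)
Lemma gaussian_forms_laplace (lam : 'I_n -> R) (a : 'I_n -> 'I_m -> R) :
  (forall i, 0 < 1 + 2 * lam i * \sum_j a i j ^+ 2) ->
  (\int[P]_w (expR (- \sum_i lam i * (\sum_j a i j * G i j w) ^+ 2))%:E =
   (\prod_i (Num.sqrt (1 + 2 * lam i * \sum_j a i j ^+ 2))^-1)%:E)%E.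
Proof.
have [J] : exists J : {set 'I_n * 'I_m}, forall i j, (i, j) \notin J -> a i j = 0.
  by exists [set: 'I_n * 'I_m]%SET => i j; rewrite inE.
move cJ : #|J| => c; elim: c J cJ lam a => [|c IH] J cJ lam a aJ lam_gt0.
  have a0 i j : a i j = 0 by apply: aJ; rewrite (cards0_eq cJ) inE.
  have s0 i : \sum_j a i j ^+ 2 = 0 by apply: big1 => j _; rewrite a0 expr0n.
  rewrite [RHS](_ : _ = 1%:E); last first.
    by congr (_%:E); apply: big1 => i _; rewrite s0 mulr0 addr0 sqrtr1 invr1.
  transitivity (\int[P]_w (cst 1%:E w))%E; last first.
    by rewrite integral_cst//= probability_setT mul1e.
  apply: eq_integral => w _ /=; congr (_%:E).
  rewrite big1 ?oppr0 ?expR0// => i _.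
  by rewrite big1 ?expr0n ?mulr0// => j _; rewrite a0 mul0r.
have [[i0 j0] ijJ] : exists ij, ij \in J.
  by apply/set0Pn; rewrite -card_gt0 cJ.
pose J' := (J :\ (i0, j0))%SET.
have cJ' : #|J'| = c.
  by move: cJ; rewrite (cardsD1 (i0, j0)) ijJ add1n => -[].
pose a' i j := if (i, j) == (i0, j0) then 0 else a i j.
have aJ' i j : (i, j) \notin J' -> a' i j = 0.
  rewrite /a' !inE negb_and negbK; case: ifP => //= _.
  exact: aJ.
pose t := a i0 j0; pose q := 1 + 2 * lam i0 * t ^+ 2.
pose lam' i := if i == i0 then lam i0 / q else lam i.
have a'E i j : i != i0 -> a' i j = a i j.
  by rewrite /a' xpair_eqE => /negbTE ->.
have sum_i0 (f : R -> 'I_m -> R) : (forall j, f 0 j = 0) ->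
    \sum_j f (a i0 j) j = f t j0 + \sum_j f (a' i0 j) j.
  move=> f0; rewrite (bigD1 j0)//= [in RHS](bigD1 j0)//= /a' eqxx f0 add0r.
  congr (_ + _); apply: eq_bigr => j jj0.
  by rewrite xpair_eqE eqxx (negbTE jj0).
(* Positivity persists when [lam i0 < 0] because [t ^ 2] is only part of the sum of
   squares of its row. *)
have q_gt0 : 0 < q.
  have := lam_gt0 i0; rewrite (sum_i0 (fun x _ => x ^+ 2)) ?expr0n// => h.
  have tau0 : 0 <= \sum_j a' i0 j ^+ 2 by apply: sumr_ge0 => j _; exact: sqr_ge0.
  rewrite /q; case: (leP 0 (lam i0)) => l0; first by have := sqr_ge0 t; nra.
  nra.
have lam'_gt0 i : 0 < 1 + 2 * lam' i * \sum_j a' i j ^+ 2.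
  have := lam_gt0 i; rewrite /lam'; case: eqP => [->|/eqP ii0] h.
    rewrite (_ : _ + _ = (q + 2 * lam i0 * \sum_j a' i0 j ^+ 2) / q).
      apply: divr_gt0 => //; move: h.
      by rewrite (sum_i0 (fun x _ => x ^+ 2)) ?expr0n// /q mulrDr addrA.
    by field; rewrite gt_eqF.
  by under eq_bigr do rewrite a'E//.
have := IH J' cJ' lam' a' aJ' lam'_gt0.
pose S w i := \sum_j a' i j * G i j w.
pose F (z : sub_space X J' * measurableTypeR R) : \bar R :=
  (expR (- \sum_(i | i != i0) lam i * S z.1 i ^+ 2) *
   expR (- (lam i0 * (S z.1 i0 + t * z.2) ^+ 2)))%:E.
have mS i : measurable_fun setT (fun z : sub_space X J' * measurableTypeR R => S z.1 i).
  apply: (@measurableT_comp _ _ _ _ _ _ ((fun w => S w i) : sub_space X J' -> R)) => //.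
  apply: measurable_sum => j; have [ijJ'|ijJ'] := boolP ((i, j) \in J').
    apply: measurable_funM => //.
    exact: (@measurable_sub_space _ _ _ _ _ X J' (i, j)).
  by under eq_fun do rewrite aJ'// mul0r; exact: measurable_cst.
have mF : measurable_fun setT F.
  apply/measurable_EFinP; apply: measurable_funM.
    apply: measurableT_comp => //; apply: measurableT_comp => //.
    rewrite (_ : (fun _ => _) = fun z : sub_space X J' * measurableTypeR R =>
        \sum_i (if i != i0 then lam i * S z.1 i ^+ 2 else 0)); last first.
      by apply/funext => z; rewrite big_mkcond.
    apply: measurable_sum => i; case: (i != i0); last exact: measurable_cst.
    apply: measurable_funM; first exact: measurable_cst.
    by apply: measurable_funX; exact: mS.
  apply: measurableT_comp => //; apply: measurableT_comp => //.
  apply: measurable_funM => //; apply: measurable_funX; apply: measurable_funD => //.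
  exact: measurable_funM.
move=> IHa'.
transitivity (\int[P]_w F (w, X (i0, j0) w))%E.
  apply: eq_integral => w _; rewrite /F /= -expRD; congr (expR _)%:E.
  rewrite (bigD1 i0)//= opprD addrC.
  rewrite (sum_i0 (fun x j => x * G i0 j w)) => [|j]; last by rewrite mul0r.
  rewrite [t * _ + _]addrC; congr (- _ - _).
  apply: eq_bigr => i ii0; congr (_ * _ ^+ 2).
  by apply: eq_bigr => j _; rewrite a'E.
rewrite (@freezing _ _ _ _ _ X hG.2 J' (i0, j0) (normal_prob 0 1))//; last 3 first.
- by rewrite !inE eqxx.
- exact: (hG.1 i0 j0).
- by move=> z; rewrite lee_fin mulr_ge0 ?expR_ge0.
transitivity (\int[P]_w ((Num.sqrt q)^-1%:E *
    (expR (- \sum_i lam' i * S w i ^+ 2))%:E))%E.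
  apply: eq_integral => w _.
  rewrite /F /=; under eq_integral do rewrite EFinM.
  rewrite ge0_integralZl_EFin ?expR_ge0//; last first.
    apply/measurable_EFinP; apply: measurableT_comp => //.
    apply: measurableT_comp => //; apply: measurable_funM => //.
    by apply: measurable_funX; apply: measurable_funD => //; exact: measurable_funM.
  rewrite integral_normal_expR_sqr//.
  rewrite -!EFinM; congr (_%:E); rewrite mulrCA -expRD; congr (_ * expR _).
  rewrite [in RHS](bigD1 i0)//= /lam' eqxx opprD addrC; congr (_ - _).
  by apply: eq_bigr => i /negbTE ->.
have mE : measurable_fun setT (fun w : T => (expR (- \sum_i lam' i * S w i ^+ 2))%:E).
  apply/measurable_EFinP; apply: measurableT_comp => //; apply: measurableT_comp => //.
  apply: measurable_sum => i; apply: measurable_funM => //; apply: measurable_funX.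
  by apply: measurable_sum => j; exact: measurable_funM.
rewrite ge0_integralZl_EFin ?invr_ge0 ?sqrtr_ge0//.
rewrite IHa' -EFinM; congr (_%:E).
rewrite (bigD1 i0)//= [in RHS](bigD1 i0)//= mulrA; congr (_ * _); last first.
  apply: eq_bigr => i ii0; rewrite /lam' (negbTE ii0).
  by under eq_bigr do rewrite a'E//.
rewrite -invfM -sqrtrM ?(ltW q_gt0)//; congr (Num.sqrt _)^-1.
rewrite (sum_i0 (fun x _ => x ^+ 2)) ?expr0n// /lam' eqxx /q.
by field; rewrite -/q gt_eqF.
Qed.

End GaussianForms.

(** * Exponential moments of a Gaussian matrix *)

Section GaussianMatrix.
Context {d : measure_display} {T : measurableType d} {R : realType}.
Variable P : probability T R.
Context {n m : nat} (G : 'I_n -> 'I_m -> {RV P >-> R}).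

Definition gaussian_mx (w : T) : 'M[R]_(n, m) := \matrix_(i < n, j < m) G i j w.

Lemma sqn_gaussian_mx w (x : 'cV[R]_m) :
  sqn (gaussian_mx w *m x) = \sum_i (\sum_j x j 0 * G i j w) ^+ 2.
Proof.
apply: eq_bigr => i _; rewrite mxE; congr (_ ^+ 2).
by apply: eq_bigr => j _; rewrite mxE mulrC.
Qed.

Lemma measurable_sqn_gaussian_mx (x : 'cV[R]_m) :
  measurable_fun setT (fun w => sqn (gaussian_mx w *m x)).
Proof.
under eq_fun do rewrite sqn_gaussian_mx.
apply: measurable_sum => i; apply: measurable_funX.
by apply: measurable_sum => j; apply: measurable_funM.
Qed.

Hypothesis hG : std_gaussian_matrix G.

Lemma gaussian_laplace (lam : R) (x : 'cV[R]_m) : 0 < 1 + 2 * lam * sqn x ->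
  (\int[P]_w (expR (- (lam * sqn (gaussian_mx w *m x))))%:E =
   ((Num.sqrt (1 + 2 * lam * sqn x))^-1 ^+ n)%:E)%E.
Proof.
move=> lx; have := @gaussian_forms_laplace _ _ _ _ _ _ _ hG (fun=> lam) (fun _ j => x j 0).
rewrite -/(sqn x) prodr_const card_ord => <- //.
by apply: eq_integral => w _; rewrite sqn_gaussian_mx mulr_sumr.
Qed.

Lemma integral_laplace_weight (lam : R) (x : 'cV[R]_m) : 0 <= lam ->
  (\int[P]_w (laplace_weight lam (gaussian_mx w) x)%:E = 1)%E.
Proof.
move=> lam0; have lx : 0 < 1 + 2 * lam * sqn x.
  by rewrite ltr_pwDl// mulr_ge0 ?sqn_ge0// mulr_ge0.
have s0 : 0 < Num.sqrt (1 + 2 * lam * sqn x) by rewrite sqrtr_gt0.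
rewrite /laplace_weight; under eq_integral do rewrite mulrC EFinM.
rewrite ge0_integralZl_EFin ?exprn_ge0 ?(ltW s0)//; last first.
  apply/measurable_EFinP; apply: measurableT_comp => //; apply: measurableT_comp => //.
  by apply: measurable_funM => //; exact: measurable_sqn_gaussian_mx.
by rewrite gaussian_laplace// -EFinM -exprMn divff ?expr1n// gt_eqF.
Qed.

Lemma measurable_laplace_weight (lam : R) (x : 'cV[R]_m) :
  measurable_fun setT (fun w => laplace_weight lam (gaussian_mx w) x).
Proof.
apply: measurable_funM => //.
apply: measurableT_comp => //; apply: measurableT_comp => //.
by apply: measurable_funM => //; exact: measurable_sqn_gaussian_mx.
Qed.

Lemma integral_iid_mean (A : finType) (w : A -> R) k (F : seq A -> T -> R) :
  (forall a, 0 <= w a) -> (forall s, measurable_fun setT (F s)) ->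
  (forall s x, 0 <= F s x) -> (forall s, \int[P]_x (F s x)%:E = 1)%E ->
  measurable_fun setT (fun x => iid_mean w k (F ^~ x)) /\
  (\int[P]_x (iid_mean w k (F ^~ x))%:E = ((\sum_a w a) ^+ k)%:E)%E.
Proof.
move=> w0; elim: k F => [|k IH] F mF F0 F1 /=; first by rewrite expr0 F1.
have IHa a := IH (fun s => F (a :: s)) (fun s => mF _) (fun s => F0 _) (fun s => F1 _).
have mE a : measurable_fun setT (fun x => w a * iid_mean w k (fun s => F (a :: s) x)).
  by apply: measurable_funM => //; exact: (IHa a).1.
have E0 a x : 0 <= iid_mean w k (fun s => F (a :: s) x).
  have := @le_iid_mean _ _ w k (fun=> 0) (fun s => F (a :: s) x) w0.
  by rewrite iid_mean_cst mulr0; apply => s _.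
split; first exact: measurable_sum.
under eq_integral do rewrite -sumEFin.
rewrite ge0_integral_sum//; last 2 first.
- by move=> a; apply/measurable_EFinP.
- by move=> a x _; rewrite lee_fin mulr_ge0.
rewrite exprS mulr_suml -sumEFin; apply: eq_bigr => a _.
under eq_integral do rewrite EFinM.
rewrite ge0_integralZl_EFin//; last 2 first.
- by move=> x _; rewrite lee_fin.
- by apply/measurable_EFinP; exact: (IHa a).1.
by rewrite (IHa a).2 EFinM.
Qed.

Lemma markov_expR (f : T -> R) (c : R) : measurable_fun setT f ->
  (forall x, 0 <= f x) -> (\int[P]_x (f x)%:E <= 1)%E ->
  measurable [set x | expR c <= f x] /\
  (P [set x | (expR c <= f x)%R] <= (expR (- c))%:E)%E.
Proof.
move=> mf f0 f1.
have mEf : measurable_fun setT (EFin \o f) by exact/measurable_EFinP.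
have setE : [set: T] `&` [set x | ((expR c)%:E <= `|(EFin \o f) x|)%E] =
    [set x | (expR c <= f x)%R].
  by rewrite setTI; apply/seteqP; split => x /=; rewrite ger0_norm ?lee_fin.
split.
  by rewrite -setE; apply: emeasurable_fun_c_infty => //; exact: measurableT_comp.
have := le_integral_abse P measurableT mEf (expR_gt0 c).
rewrite (_ : (\int[P]_x `|(EFin \o f) x|)%E = (\int[P]_x (f x)%:E)%E); last first.
  by apply: eq_integral => x _ /=; rewrite ger0_norm.
rewrite setE => /le_trans /(_ f1).
have mE : measurable [set x | (expR c <= f x)%R].
  by rewrite -setE; apply: emeasurable_fun_c_infty => //; exact: measurableT_comp.
have pfin : P [set x | (expR c <= f x)%R] \is a fin_num by rewrite fin_num_measure.
move=> h; have {h} : ((expR c)%:E * P [set x | (expR c <= f x)%R] <= 1)%E by exact: h.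
rewrite -(fineK pfin) -EFinM !lee_fin expRN => h.
by rewrite -[leRHS]mul1r ler_pdivlMr ?expR_gt0// mulrC.
Qed.

(** The first average has mean at most [1] because [laplace_weight] does; the second has
    mean at most [exp n] because a column satisfies
    [E exp (|G e_j| ^ 2 / 4) = 2 ^ (n / 2)]. Markov's inequality loses [exp n] in
    each case. *)
Lemma good_event (A : finType) (prior : A -> R) (v : A -> 'cV[R]_m) (lam : R)
    (mu : 'I_m -> R) :
  (forall a, 0 <= prior a) -> \sum_a prior a <= 1 -> 0 <= lam ->
  (forall j, 0 <= mu j) -> \sum_j mu j <= 1 ->
  exists Om : set T, [/\ measurable Om,
    ((1 - 2 * expR (- n%:R))%:E <= P Om)%E &
    forall w, Om w ->
      iid_mean prior n (fun s => laplace_weight lam (gaussian_mx w) (empirical n v s)) <= expR n%:R /\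
      \sum_j mu j * expR (sqn (gaussian_mx w *m delta_mx j 0) / 4) <= expR (2 * n%:R)].
Proof.
move=> prior0 prior1 lam0 mu0 mu1.
pose Psi w := iid_mean prior n (fun s => laplace_weight lam (gaussian_mx w) (empirical n v s)).
pose Phi w := expR (- n%:R) * \sum_j mu j * expR (sqn (gaussian_mx w *m delta_mx j 0) / 4).
have [mPsi iPsi] := @integral_iid_mean A prior n
  (fun s w => laplace_weight lam (gaussian_mx w) (empirical n v s)) prior0
  (fun s => measurable_laplace_weight lam _) (fun s w => laplace_weight_ge0 _ _ _)
  (fun s => integral_laplace_weight _ lam0).
have Psi0 w : 0 <= Psi w.
  have := @le_iid_mean _ _ prior n (fun=> 0)
     (fun s => laplace_weight lam (gaussian_mx w) (empirical n v s)) prior0.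
  by rewrite iid_mean_cst mulr0; apply => s _; exact: laplace_weight_ge0.
have mterm j : measurable_fun setT
    (fun w => mu j * expR (sqn (gaussian_mx w *m delta_mx j 0) / 4)).
  apply: measurable_funM => //; apply: measurableT_comp => //.
  by apply: measurable_funM => //; exact: measurable_sqn_gaussian_mx.
have mPhi : measurable_fun setT Phi.
  by apply: measurable_funM => //; exact: measurable_sum.
have Phi0 w : 0 <= Phi w.
  by rewrite mulr_ge0 ?expR_ge0// sumr_ge0// => j _; rewrite mulr_ge0 ?expR_ge0.
have iPsi1 : (\int[P]_w (Psi w)%:E <= 1)%E.
  rewrite iPsi lee_fin exprn_ile1//; exact: sumr_ge0.
have iPhi1 : (\int[P]_w (Phi w)%:E <= 1)%E.
  under eq_integral do rewrite EFinM -sumEFin.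
  rewrite ge0_integralZl_EFin ?expR_ge0//; last 2 first.
  - by move=> w _; apply: sume_ge0 => j _; rewrite lee_fin mulr_ge0 ?expR_ge0.
  - by under eq_fun do rewrite sumEFin; apply/measurable_EFinP; exact: measurable_sum.
  rewrite ge0_integral_sum//; last 2 first.
  - by move=> j; apply/measurable_EFinP.
  - by move=> j w _; rewrite lee_fin mulr_ge0 ?expR_ge0.
  have term j : (\int[P]_w (mu j * expR (sqn (gaussian_mx w *m delta_mx j 0) / 4))%:E <=
      (mu j * expR n%:R)%:E)%E.
    under eq_integral do rewrite EFinM.
    rewrite ge0_integralZl_EFin//; last first.
      apply/measurable_EFinP; apply: measurableT_comp => //.
      by apply: measurable_funM => //; exact: measurable_sqn_gaussian_mx.
    rewrite (_ : (\int[P]_w _)%E =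
        (\int[P]_w (expR (- (- 4^-1 * sqn (gaussian_mx w *m delta_mx j 0))))%:E)%E); last first.
      by apply: eq_integral => w _; rewrite mulNr opprK mulrC.
    rewrite gaussian_laplace sqn_delta; last by lra.
    rewrite EFinM lee_wpmul2l ?lee_fin// -[n%:R]mulr1 expRM_natl.
    apply: lerXn2r; rewrite ?nnegrE ?invr_ge0 ?sqrtr_ge0 ?expR_ge0//.
    (* [sqrt 2 <= 2 <= e] *)
    have e2 : 2 <= expR 1 :> R by apply: le_trans (expR_ge1Dx _); rewrite -natr1.
    rewrite (le_trans _ e2)// -sqrtrV; last by lra.
    have -> : 1 + 2 * - 4^-1 * 1 = 2^-1 :> R by field.
    by rewrite invrK -[leRHS](@ger0_norm R 2)// -sqrtr_sqr ler_sqrt// ler_eXnr// ler1n.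
  apply: (@le_trans _ _ (expR (- n%:R) * (\sum_j mu j * expR n%:R))%:E).
    rewrite EFinM lee_wpmul2l ?lee_fin ?expR_ge0// -sumEFin.
    by apply: lee_sum => j _; exact: term.
  rewrite lee_fin -mulr_suml mulrCA -expRD addrC subrr expR0 mulr1 //.
have [m1 P1] := markov_expR n%:R mPsi Psi0 iPsi1.
have [m2 P2] := markov_expR n%:R mPhi Phi0 iPhi1.
exists (~` ([set w | expR n%:R <= Psi w] `|` [set w | expR n%:R <= Phi w])); split.
- by apply: measurableC; exact: measurableU.
- rewrite probability_setC; last exact: measurableU.
  rewrite EFinB; apply: leeB => //.
  apply: (le_trans (measureU2 _ m1 m2)).
  by rewrite mulr_natl mulr2n EFinD; exact: leeD.
- move=> w /= /not_orP[/negP h1 /negP h2]; split; first by rewrite ltW// ltNge.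
  have h3 : Phi w < expR n%:R by rewrite ltNge.
  have := ltW h3; rewrite /Phi expRN ler_pdivrMl ?expR_gt0//.
  by rewrite mulr_natl mulr2n expRD.
Qed.

End GaussianMatrix.

(** * Sampling signed coordinates *)

Section LogPlus.
Context {R : realType}.

(** Positive part of the logarithm. *)
Definition lnplus (x : R) : R := ln (Num.max 1 x).

Lemma lnplus_ge0 x : 0 <= lnplus x.
Proof. by rewrite ln_ge0// le_max lexx. Qed.

Lemma expR_lnplus x : expR (lnplus x) = Num.max 1 x.
Proof. by rewrite lnK// posrE lt_max ltr01. Qed.

Lemma le_expR_lnplus x : x <= expR (lnplus x).
Proof. by rewrite expR_lnplus le_max lexx orbT. Qed.

Lemma ler_lnplus x y : x <= y -> lnplus x <= lnplus y.
Proof.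
move=> xy; rewrite /lnplus ler_ln ?posrE ?lt_max ?ltr01//.
by rewrite ge_max !le_max lexx xy orbT.
Qed.

Lemma lnplus_le x : 0 <= x -> lnplus x <= x.
Proof.
move=> x0; rewrite /lnplus; have [x1|x1] := leP x 1; first by rewrite ln1.
by rewrite ltW// ln_sublinear//; lra.
Qed.

(** Young's inequality for the conjugate pair [x ln x], [exp]. *)
Lemma young_lnplus (a mu phi : R) : 0 <= a -> 0 < mu ->
  a * phi <= a * lnplus (a / mu) + mu * expR phi.
Proof.
move=> a0 mu0; have [phi0|phi0] := leP phi (lnplus (a / mu)).
  rewrite -[leLHS]addr0; apply: lerD; first exact: ler_wpM2l.
  by rewrite mulr_ge0 ?expR_ge0// ltW.
rewrite -lerBlDl -mulrBr.
have h1 : a <= mu * expR (lnplus (a / mu)).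
  by rewrite -ler_pdivrMl// mulrC le_expR_lnplus.
have h2 : phi - lnplus (a / mu) <= expR (phi - lnplus (a / mu)).
  by apply: le_trans (expR_ge1Dx _); rewrite lerDr.
have h3 : mu * expR phi = (mu * expR (lnplus (a / mu))) * expR (phi - lnplus (a / mu)).
  by rewrite -mulrA -expRD addrCA subrr addr0.
rewrite h3; apply: ler_pM => //; lra.
Qed.

End LogPlus.

Section CoordinateAtoms.
Context {R : realType} {n m : nat}.
Implicit Types (t mu : 'I_m -> R) (y : 'cV[R]_m).

(** The atom [None] is the origin; it takes the mass that the coordinates leave. *)
Definition atom_prior mu (a : option ('I_m * bool)) : R :=
  if a is Some (j, _) then mu j / 4 else 2^-1.

Definition atom_vec t (a : option ('I_m * bool)) : 'cV[R]_m :=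
  if a is Some (j, b) then ((-1) ^+ b * t j) *: delta_mx j 0 else 0.

Definition atom_law t y (a : option ('I_m * bool)) : R :=
  if a is Some (j, b) then Num.max 0 ((-1) ^+ b * y j 0) / t j
  else 1 - \sum_j `|y j 0| / t j.

Lemma sum_atoms (F : option ('I_m * bool) -> R) :
  \sum_a F a = F None + \sum_j (F (Some (j, false)) + F (Some (j, true))).
Proof.
rewrite (bigD1 None)//=; congr (_ + _).
rewrite (reindex_omap Some id)/=; last by case.
rewrite (eq_bigl xpredT)//=; last by move=> i; rewrite eqxx.
rewrite (eq_bigr (fun p : 'I_m * bool => F (Some (p.1, p.2)))); last by case.
rewrite -(pair_bigA _ (fun j b => F (Some (j, b))))/=; apply: eq_bigr => j _.
by rewrite big_bool addrC.
Qed.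

Lemma sum_atom_prior mu : \sum_j mu j <= 1 -> \sum_a atom_prior mu a <= 1.
Proof.
move=> mu1; rewrite sum_atoms /=.
have -> : \sum_j (mu j / 4 + mu j / 4) = (\sum_j mu j) / 2.
  by rewrite mulr_suml; apply: eq_bigr => j _; field.
lra.
Qed.

(** The weights [max 0 y] and [max 0 (- y)] of the two signs make [atom_law] a
    probability with the right barycenter, through the two identities below. *)
Lemma max_sign_add (x : R) : Num.max 0 x + Num.max 0 (- x) = `|x|.
Proof.
case: (lerP 0 x) => x0; first by rewrite max_l ?oppr_le0// addr0 ger0_norm.
by rewrite add0r max_r ?oppr_ge0 ?(ltW x0)// ltr0_norm.
Qed.

Lemma max_sign_sub (x : R) : Num.max 0 x - Num.max 0 (- x) = x.
Proof.
case: (lerP 0 x) => x0; first by rewrite max_l ?oppr_le0// subr0.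
by rewrite max_r ?oppr_ge0 ?(ltW x0)// opprK add0r.
Qed.

Lemma sum_atom_law (t : 'I_m -> R) y (c0 : R) (c : 'I_m -> R) :
  \sum_a atom_law t y a * (if a is Some (j, _) then c j else c0) =
  (1 - \sum_j `|y j 0| / t j) * c0 + \sum_j `|y j 0| / t j * c j.
Proof.
rewrite sum_atoms /=; congr (_ + _); apply: eq_bigr => j _.
by rewrite expr0 expr1 mul1r mulN1r -mulrDl -mulrDl max_sign_add.
Qed.

Lemma barycenter_atoms t y : (forall j, 0 < t j) ->
  y = \sum_a atom_law t y a *: atom_vec t a.
Proof.
move=> t0; apply/colP => i; rewrite summxE.
under eq_bigr do rewrite mxE.
rewrite sum_atoms /= mxE mulr0 add0r (bigD1 i)//= big1 ?addr0; last first.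
  by move=> j ji; rewrite !mxE eq_sym (negbTE ji) !mulr0 addr0.
rewrite !mxE !eqxx /= expr0 expr1 !mulr1 !mul1r !mulN1r.
rewrite mulrN -mulNr -mulrDl -mulNr -mulrDl max_sign_sub mulfVK// gt_eqF//.
Qed.

Lemma sqn_mul_atom k (A : 'M[R]_(k, m)) t j b :
  sqn (A *m atom_vec t (Some (j, b))) = t j ^+ 2 * sqn (A *m delta_mx j 0).
Proof. by rewrite /= -scalemxAr sqnZ exprMn sqrr_sign mul1r. Qed.

(** [maurey_lower_bound] for signed coordinates. The factor [4] in the entropy is
    the ratio between [mu j] and its share [mu j / 4] in the prior; the origin has
    prior mass [1/2] and adds at most [ln 2 <= 1] to the entropy. *)
Lemma sparse_lower_bound (A : 'M[R]_(n, m)) t mu y (H D B V : R) :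
  (0 < n)%N -> 0 < H -> 0 < D -> 0 < B -> 0 < V ->
  (forall j, 0 < t j) -> (forall j, 0 < mu j) ->
  \sum_j `|y j 0| / t j <= 1 ->
  \sum_j `|y j 0| / t j * lnplus (4 * (`|y j 0| / t j) / mu j) <= H ->
  \sum_j `|y j 0| * t j <= V ->
  \sum_j `|y j 0| * t j * sqn (A *m delta_mx j 0) <= n%:R * (D * V) ->
  iid_mean (atom_prior mu) n (fun s => laplace_weight (n%:R / ((2 * B + 8 * D) * V)) A
     (empirical n (atom_vec t) s)) <= expR n%:R ->
  sqn (A *m y) <= B * V ->
  sqn y < (8 + (2 * B + 8 * D) * sampling_level (H + 1) ^+ 2) * V / n%:R.
Proof.
move=> n0 H0 D0 B0 V0 t0 mu0 nu1 nuH yV yA Psi AyB.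
pose l (a : option ('I_m * bool)) : R :=
  if a is Some (j, _) then lnplus (4 * (`|y j 0| / t j) / mu j) else ln 2.
have ln2_1 : ln 2 <= 1 :> R.
  have := @le_ln1Dx R 1; rewrite -natr1; apply; lra.
have nu0 j : 0 <= `|y j 0| / t j by rewrite divr_ge0// ltW.
have nuS0 : 0 <= \sum_j `|y j 0| / t j by exact: sumr_ge0.
apply: (@maurey_lower_bound _ _ n m A (atom_prior mu) (atom_law t y) l (atom_vec t))
  => //; first lra.
- case=> [[j b]|] /=; last by rewrite invr_ge0.
  by rewrite divr_ge0// ltW.
- case=> [[j b]|] /=; last by lra.
  by rewrite divr_ge0 ?le_max ?lexx// ltW.
- have := sum_atom_law t y 1 (fun=> 1).
  rewrite (eq_bigr (atom_law t y)) => [->|[[j b]|] _]; rewrite ?mulr1//.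
  by under [X in _ + X]eq_bigr do rewrite mulr1; rewrite subrK.
- case=> [[j b]|] /=; first exact: lnplus_ge0.
  by rewrite ln_ge0// ler1n.
- case=> [[j b]|] /=; last by rewrite lnK ?posrE// divff//; lra.
  apply: (@le_trans _ _ (`|y j 0| / t j)).
    rewrite ler_pM2r ?invr_gt0//.
    rewrite ge_max normr_ge0/=; apply: le_trans (ler_norm _) _.
    by rewrite normrM normr_sign mul1r.
  rewrite -ler_pdivrMr ?divr_gt0//.
  apply: le_trans (le_expR_lnplus _).
  have m0 := mu0 j; have t0' := t0 j.
  by rewrite le_eqVlt; apply/orP; left; apply/eqP; field; rewrite !gt_eqF.
- rewrite (eq_bigr (fun a => atom_law t y a * (if a is Some (j, _) then
     lnplus (4 * (`|y j 0| / t j) / mu j) else ln 2))); last by case=> [[]|].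
  rewrite sum_atom_law addrC; apply: lerD => //.
  rewrite -[leRHS]mulr1; apply: ler_pM => //; try lra.
  by rewrite ln_ge0// ler1n.
- exact: barycenter_atoms.
- rewrite (eq_bigr (fun a => atom_law t y a * (if a is Some (j, _) then
     t j ^+ 2 else 0))); last first.
    move=> [[j b]|] _; last by rewrite sqn0.
    by rewrite -[atom_vec _ _]mul1mx sqn_mul_atom mul1mx sqn_delta mulr1.
  rewrite sum_atom_law mulr0 add0r; apply: le_trans yV; apply: ler_sum => j _.
  by rewrite expr2 mulrA divfK ?gt_eqF.
- rewrite (eq_bigr (fun a => atom_law t y a * (if a is Some (j, _) then
     t j ^+ 2 * sqn (A *m delta_mx j 0) else 0))); last first.
    move=> [[j b]|] _; first by rewrite sqn_mul_atom.
    by rewrite mulmx0 sqn0.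
  rewrite sum_atom_law mulr0 add0r; apply: le_trans yA; apply: ler_sum => j _.
  by rewrite expr2 !mulrA divfK ?gt_eqF.
Qed.

End CoordinateAtoms.

(** * Sections of sets with few unconstrained coordinates *)

Section HeadTail.
Context {R : realType} {n m : nat}.
Variables (h : nat) (r V : R) (t mu : 'I_m -> R).
Hypotheses (n0 : (0 < n)%N) (hm : (h <= m)%N) (r0 : 0 < r) (V0 : 0 < V).
Hypotheses (t0 : forall i, 0 < t i) (mu0 : forall i, 0 < mu i).
Hypothesis mu_tail : \sum_(i < m | (h <= i)%N) mu i <= 2^-1.

(** With this step the head has total mass at most [1/2] and, against the uniform
    prior of mass [1/2], bounded entropy. *)
Definition head_step : R := 2 * Num.sqrt h%:R * r.
Definition full_step (i : 'I_m) : R := if (i < h)%N then head_step else t i.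
Definition full_prior (i : 'I_m) : R := if (i < h)%N then (2 * h%:R)^-1 else mu i.

(** What a tail must satisfy to be sampled together with the head: it uses at most
    half of the mass and half of the entropy budget of [sparse_lower_bound]. *)
Definition tail_sampled (A : 'M[R]_(n, m)) (y : 'cV[R]_m) : Prop :=
  [/\ \sum_(i < m | (h <= i)%N) `|y i 0| / t i <= 2^-1,
      \sum_(i < m | (h <= i)%N) `|y i 0| / t i * lnplus (4 * (`|y i 0| / t i) / mu i) <= 2,
      \sum_(i < m | (h <= i)%N) `|y i 0| * t i <= V &
      \sum_(i < m | (h <= i)%N) `|y i 0| * t i * sqn (A *m delta_mx i 0)
        <= n%:R * (32 * V)].

(** The constant of [sparse_lower_bound] for entropy [4] (two for the head and two
    for the tail), [D = 32] and [B = 8]. *)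
Definition radius_const : R := 8 + (2 * 8 + 8 * 32) * sampling_level (4 + 1) ^+ 2.

Lemma sum_head_tail (F : 'I_m -> R) :
  \sum_i F i = \sum_(i < m | (i < h)%N) F i + \sum_(i < m | (h <= i)%N) F i.
Proof.
rewrite (bigID (fun i : 'I_m => (i < h)%N)) /=; congr (_ + _).
by apply: eq_bigl => i; rewrite -leqNgt.
Qed.

Lemma sum_head_const (c : R) : \sum_(i < m | (i < h)%N) c = h%:R * c.
Proof.
by rewrite -(big_ord_widen m (fun=> c))// sumr_const card_ord mulr_natl.
Qed.

(** Controls the variance of the images of the atoms: [a] is their law and [phi] a
    multiple of the squared norms of the columns, known only through an exponential
    moment under the prior. *)
Lemma young_sum (Q : pred 'I_m) (a w phi : 'I_m -> R) :
  (forall i, 0 <= a i) -> (forall i, 0 < w i) ->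
  \sum_(i | Q i) w i * expR (phi i) <= expR (2 * n%:R) ->
  \sum_(i | Q i) a i * phi i <=
  2 * n%:R * \sum_(i | Q i) a i + \sum_(i | Q i) a i * lnplus (a i / w i) + 1.
Proof.
move=> a0 w0 wphi.
have : \sum_(i | Q i) a i * (phi i - 2 * n%:R) <=
    \sum_(i | Q i) (a i * lnplus (a i / w i) + w i * expR (phi i - 2 * n%:R)).
  by apply: ler_sum => i _; exact: young_lnplus.
rewrite big_split /=.
have : \sum_(i | Q i) w i * expR (phi i - 2 * n%:R) <= 1.
  under eq_bigr do rewrite expRD expRN mulrA.
  by rewrite -mulr_suml ler_pdivrMr ?expR_gt0// mul1r.
have -> : \sum_(i | Q i) a i * (phi i - 2 * n%:R) =
    \sum_(i | Q i) a i * phi i - 2 * n%:R * \sum_(i | Q i) a i.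
  rewrite mulr_sumr -sumrB; apply: eq_bigr => i _; ring.
lra.
Qed.

Lemma full_step_gt0 i : 0 < full_step i.
Proof.
rewrite /full_step; case: ifP => // ih.
by rewrite /head_step mulr_gt0// mulr_gt0// sqrtr_gt0 ltr0n (leq_ltn_trans _ ih).
Qed.

Lemma full_prior_gt0 i : 0 < full_prior i.
Proof.
rewrite /full_prior; case: ifP => // ih.
by rewrite invr_gt0 mulr_gt0// ltr0n (leq_ltn_trans _ ih).
Qed.

Lemma sum_full_prior : \sum_i full_prior i <= 1.
Proof.
rewrite sum_head_tail (eq_bigr (fun=> (2 * h%:R)^-1)); last first.
  by move=> i ih; rewrite /full_prior ih.
rewrite [X in _ + X](eq_bigr mu); last by move=> i; rewrite /full_prior leqNgt => /negbTE ->.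
rewrite sum_head_const; move: mu_tail; case: (posnP h) => [->|h0]; first by rewrite mul0r add0r => H; lra.
move=> H; rewrite invfM mulrCA divff ?mulr1; first by lra.
by rewrite pnatr_eq0 -lt0n.
Qed.

Section Head.
Variable y : 'cV[R]_m.
Hypothesis y_head : \sum_(i < m | (i < h)%N) y i 0 ^+ 2 <= r ^+ 2.
Hypothesis h0 : (0 < h)%N.

Let hR : 0 < h%:R :> R. Proof. by rewrite ltr0n. Qed.
Let s0 : 0 < head_step.
Proof. by rewrite /head_step mulr_gt0// mulr_gt0// sqrtr_gt0. Qed.
Let s2 : head_step ^+ 2 = 4 * h%:R * r ^+ 2.
Proof. by rewrite /head_step !exprMn sqr_sqrtr ?ltW//; ring. Qed.

Lemma head_mass : \sum_(i < m | (i < h)%N) `|y i 0| / head_step <= 2^-1.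
Proof.
apply: (@le_trans _ _ (\sum_(i < m | (i < h)%N) (y i 0 ^+ 2 / (4 * r ^+ 2) + (4 * h%:R)^-1))).
  apply: ler_sum => i _.
  (* arithmetic-geometric mean inequality *)
  have e : y i 0 ^+ 2 / (4 * r ^+ 2) + (4 * h%:R)^-1 - `|y i 0| / head_step =
     (`|y i 0| / (2 * r) - (2 * Num.sqrt h%:R)^-1) ^+ 2.
    have sh : 0 < Num.sqrt h%:R :> R by rewrite sqrtr_gt0.
    rewrite -[y i 0 ^+ 2]real_normK ?num_real// -[in LHS](sqr_sqrtr (ltW hR)) /head_step.
    by field; rewrite !gt_eqF.
  by rewrite -subr_ge0 e sqr_ge0.
rewrite big_split /= sum_head_const -mulr_suml.
have -> : h%:R * (4 * h%:R)^-1 = 4^-1 :> R by field; rewrite gt_eqF.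
have : (\sum_(i < m | (i < h)%N) y i 0 ^+ 2) / (4 * r ^+ 2) <= 4^-1.
  by rewrite ler_pdivrMr ?mulr_gt0 ?exprn_gt0// mulrA mulVf ?mul1r.
lra.
Qed.

Lemma head_entropy : \sum_(i < m | (i < h)%N)
  `|y i 0| / head_step * lnplus (4 * (`|y i 0| / head_step) / (2 * h%:R)^-1) <= 2.
Proof.
apply: (@le_trans _ _ (\sum_(i < m | (i < h)%N) 2 / r ^+ 2 * y i 0 ^+ 2)).
  apply: ler_sum => i _.
  have n0' : 0 <= `|y i 0| / head_step by rewrite divr_ge0// ltW.
  apply: (@le_trans _ _ (`|y i 0| / head_step * (4 * (`|y i 0| / head_step) / (2 * h%:R)^-1))).
    apply: ler_wpM2l => //; apply: lnplus_le; rewrite invrK.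
    by apply: mulr_ge0; [exact: mulr_ge0|rewrite mulr_ge0// ltW].
  rewrite invrK (_ : _ * _ = 8 * h%:R * (`|y i 0| ^+ 2 / head_step ^+ 2)).
    rewrite s2 real_normK ?num_real// le_eqVlt; apply/orP; left; apply/eqP.
    by field; rewrite !gt_eqF.
  by field; rewrite gt_eqF.
rewrite -mulr_sumr mulrAC ler_pdivrMr ?exprn_gt0//.
by rewrite ler_pM2l.
Qed.

Lemma head_variance : \sum_(i < m | (i < h)%N) `|y i 0| * head_step <= 2 * h%:R * r ^+ 2.
Proof.
have -> : \sum_(i < m | (i < h)%N) `|y i 0| * head_step =
    head_step ^+ 2 * \sum_(i < m | (i < h)%N) `|y i 0| / head_step.
  by rewrite mulr_sumr; apply: eq_bigr => i _; field; rewrite gt_eqF.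
rewrite s2; have := head_mass; set S := \sum_(i < m | _) _ => hS.
have : 4 * h%:R * r ^+ 2 * S <= 4 * h%:R * r ^+ 2 * 2^-1.
  by rewrite ler_pM2l// !mulr_gt0// exprn_gt0.
lra.
Qed.

Lemma head_image_variance (A : 'M[R]_(n, m)) :
  \sum_i full_prior i * expR (sqn (A *m delta_mx i 0) / 4) <= expR (2 * n%:R) ->
  \sum_(i < m | (i < h)%N) `|y i 0| * head_step * sqn (A *m delta_mx i 0) <=
  n%:R * (32 * (2 * h%:R * r ^+ 2)).
Proof.
move=> Aphi.
have a0 i : 0 <= `|y i 0| / head_step by rewrite divr_ge0// ltW.
have Aphi_head : \sum_(i < m | (i < h)%N) full_prior i * expR (sqn (A *m delta_mx i 0) / 4)
    <= expR (2 * n%:R).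
  apply: le_trans Aphi; rewrite sum_head_tail lerDl sumr_ge0// => i _.
  by rewrite mulr_ge0 ?expR_ge0 ?ltW ?full_prior_gt0.
have := @young_sum (fun i : 'I_m => (i < h)%N) _ _ _ a0 full_prior_gt0 Aphi_head.
have -> : \sum_(i < m | (i < h)%N) `|y i 0| * head_step * sqn (A *m delta_mx i 0) =
  4 * head_step ^+ 2 * \sum_(i < m | (i < h)%N)
     `|y i 0| / head_step * (sqn (A *m delta_mx i 0) / 4).
  by rewrite mulr_sumr; apply: eq_bigr => i _; field; rewrite gt_eqF.
set S := \sum_(i < m | _) _ * (_ / 4); set M := \sum_(i < m | _) _ / head_step.
set E := \sum_(i < m | _) _ * lnplus _.
have M2 : M <= 2^-1 by exact: head_mass.
have E2 : E <= 2.
  apply: le_trans head_entropy; apply: ler_sum => i ih; apply: ler_wpM2l => //.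
  apply: ler_lnplus; rewrite /full_prior ih -[4 * _ / _]mulrA ler_peMl//.
    by rewrite mulr_ge0// invrK mulr_ge0// ltW.
  by lra.
have nR : 1 <= n%:R :> R by rewrite ler1n.
move=> hS; have S4 : S <= 4 * n%:R.
  have : 2 * n%:R * M <= 2 * n%:R * 2^-1 by rewrite ler_pM2l//; lra.
  lra.
rewrite s2.
have : 4 * (4 * h%:R * r ^+ 2) * S <= 4 * (4 * h%:R * r ^+ 2) * (4 * n%:R).
  by rewrite ler_pM2l// !mulr_gt0// exprn_gt0.
lra.
Qed.

End Head.

Lemma head_tail_bound (A : 'M[R]_(n, m)) (y : 'cV[R]_m) :
  let W := 2 * h%:R * r ^+ 2 + V in
  \sum_(i < m | (i < h)%N) y i 0 ^+ 2 <= r ^+ 2 -> tail_sampled A y ->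
  \sum_i full_prior i * expR (sqn (A *m delta_mx i 0) / 4) <= expR (2 * n%:R) ->
  iid_mean (atom_prior full_prior) n (fun s => laplace_weight (n%:R / ((2 * 8 + 8 * 32) * W)) A
     (empirical n (atom_vec full_step) s)) <= expR n%:R ->
  sqn (A *m y) <= 8 * W -> sqn y < radius_const * W / n%:R.
Proof.
move=> W yh [y1 y2 y3 y4] Aphi Psi Ay.
have W0 : 0 < W by rewrite /W ltr_wpDl// mulr_ge0 ?sqr_ge0// mulr_ge0.
have head0 (F : 'I_m -> R) : h = 0%N -> \sum_(i < m | (i < h)%N) F i = 0.
  by move=> ->; rewrite big_pred0.
have tailE (F : R -> R -> 'I_m -> R) : \sum_(i < m | (h <= i)%N)
    F (full_step i) (full_prior i) i = \sum_(i < m | (h <= i)%N) F (t i) (mu i) i.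
  by apply: eq_bigr => i; rewrite /full_step /full_prior leqNgt => /negbTE ->.
have headE (F : R -> R -> 'I_m -> R) : \sum_(i < m | (i < h)%N)
    F (full_step i) (full_prior i) i =
    \sum_(i < m | (i < h)%N) F head_step (2 * h%:R)^-1 i.
  by apply: eq_bigr => i; rewrite /full_step /full_prior => ->.
apply: (@sparse_lower_bound _ n m A full_step full_prior y 4 32 8 W) => //.
- exact: full_step_gt0.
- exact: full_prior_gt0.
- rewrite sum_head_tail (headE (fun s _ i => `|y i 0| / s)) (tailE (fun s _ i => `|y i 0| / s)).
  have : \sum_(i < m | (i < h)%N) `|y i 0| / head_step <= 2^-1.
    by case: (posnP h) => [/head0 ->|/(head_mass yh)//]; lra.
  lra.
- pose F s w i := `|y i 0| / s * lnplus (4 * (`|y i 0| / s) / w).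
  rewrite sum_head_tail (headE F) (tailE F).
  have : \sum_(i < m | (i < h)%N) F head_step (2 * h%:R)^-1 i <= 2.
    by case: (posnP h) => [/head0 ->|/(head_entropy yh)//]; lra.
  rewrite /F; lra.
- rewrite sum_head_tail (headE (fun s _ i => `|y i 0| * s)) (tailE (fun s _ i => `|y i 0| * s)).
  apply: lerD => //; case: (posnP h) => [/[dup] /head0 -> ->|/(head_variance yh)//].
  by rewrite mulr0 mul0r.
- pose F s (w : R) i := `|y i 0| * s * sqn (A *m delta_mx i 0).
  rewrite sum_head_tail (headE F) (tailE F) /W !mulrDr; apply: lerD => //.
  case: (posnP h) => [/[dup] /head0 -> ->|/(head_image_variance yh) H]; last exact: H.
  by rewrite !(mulr0, mul0r).
Qed.

End HeadTail.

Lemma radius_const_ge {R : realType} : 8 <= radius_const :> R.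
Proof. by rewrite /radius_const lerDl mulr_ge0// sqr_ge0. Qed.

(** A kernel vector longer than [r] can be shrunk to norm [r]; [head_tail_bound] then
    bounds [r ^ 2] by a multiple of [(2 h r ^ 2 + V) / n], up to the part [x - y]
    that is not sampled. A short head and a small [V] make this a contradiction. *)
Lemma kernel_radius {R : realType} {d} {T : measurableType d} (P : probability T R)
    {n m : nat} (G : 'I_n -> 'I_m -> {RV P >-> R}) (K : set 'cV[R]_m)
    (h : nat) (r V : R) (t mu : 'I_m -> R) :
  std_gaussian_matrix G -> (0 < n)%N -> (h <= m)%N -> 0 < r -> 0 < V ->
  (forall i, 0 < t i) -> (forall i, 0 < mu i) ->
  \sum_(i < m | (h <= i)%N) mu i <= 2^-1 ->
  16 * radius_const * h%:R <= n%:R :> R ->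
  8 * radius_const * V <= n%:R * r ^+ 2 ->
  (forall (c : R) x, K x -> 0 <= c <= 1 -> K (c *: x)) ->
  (forall (A : 'M[R]_(n, m)) x,
     \sum_(i < m | (h <= i)%N) mu i * expR (sqn (A *m delta_mx i 0) / 4)
       <= expR (2 * n%:R) ->
     K x -> A *m x = 0 ->
     exists y : 'cV[R]_m, [/\ (forall i : 'I_m, (i < h)%N -> y i 0 = x i 0),
       tail_sampled h V t mu A y, sqn (x - y) <= r ^+ 2 / 8 & sqn (A *m y) <= 8 * V]) ->
  exists Om : set T, [/\ measurable Om, ((1 - 2 * expR (- n%:R))%:E <= P Om)%E &
    forall w, Om w -> forall x, K x -> gaussian_mx G w *m x = 0 -> sqn x <= r ^+ 2].
Proof.
move=> hG n0 hm r0 V0 t0 mu0 mu_tail hn Vn Kstar Ksplit.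
pose W := 2 * h%:R * r ^+ 2 + V.
have W0 : 0 < W by rewrite /W ltr_wpDl// mulr_ge0 ?sqr_ge0// mulr_ge0.
have C8 := @radius_const_ge R; set C := radius_const in hn Vn C8 *.
pose lam : R := n%:R / ((2 * 8 + 8 * 32) * W).
have lam0 : 0 <= lam by rewrite divr_ge0// mulr_ge0 ?(ltW W0)//; lra.
have w0 := @full_prior_gt0 R m h mu mu0.
have prior0 a : 0 <= atom_prior (full_prior h mu) a.
  by case: a => [[j b]|] /=; rewrite ?invr_ge0// divr_ge0// ltW.
have [Om [mOm POm OmP]] := good_event hG (atom_vec (full_step h r t)) prior0
   (sum_atom_prior (sum_full_prior hm mu_tail)) lam0 (fun i => ltW (w0 i))
   (sum_full_prior hm mu_tail).
exists Om; split => // w /OmP[Psi Phi] x Kx Gx0.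
rewrite leNgt; apply/negP => xr.
have x0 : 0 < sqn x by rewrite (le_lt_trans _ xr)// sqr_ge0.
pose c := r / Num.sqrt (sqn x).
have sx0 : 0 < Num.sqrt (sqn x) by rewrite sqrtr_gt0.
have c01 : 0 <= c <= 1.
  rewrite divr_ge0 ?(ltW r0) ?(ltW sx0)//= ler_pdivrMr// mul1r.
  by rewrite -(ger0_norm (ltW r0)) -sqrtr_sqr ler_sqrt ltW.
have cx : sqn (c *: x) = r ^+ 2.
  by rewrite sqnZ /c expr_div_n sqr_sqrtr ?(ltW x0)// divfK// gt_eqF.
have Phi_tail : \sum_(i < m | (h <= i)%N) mu i * expR (sqn (gaussian_mx G w *m delta_mx i 0) / 4)
       <= expR (2 * n%:R).
  apply: le_trans Phi; rewrite (sum_head_tail h) -[leLHS]add0r; apply: lerD.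
    by apply: sumr_ge0 => i _; rewrite mulr_ge0 ?expR_ge0// ltW.
  by apply: ler_sum => i; rewrite /full_prior leqNgt => /negbTE ->.
have [y [yx ysamp xy Ay]] := Ksplit _ _ Phi_tail (Kstar _ _ Kx c01)
  (etrans (esym (scalemxAr _ _ _)) (etrans (congr1 _ Gx0) (scaler0 _ _))).
have yh : \sum_(i < m | (i < h)%N) y i 0 ^+ 2 <= r ^+ 2.
  rewrite -cx /sqn [leRHS](sum_head_tail h) -[leLHS]addr0; apply: lerD.
    by apply: ler_sum => i ih; rewrite yx.
  by apply: sumr_ge0 => i _; exact: sqr_ge0.
have AyW : sqn (gaussian_mx G w *m y) <= 8 * W.
  apply: le_trans Ay _; rewrite ler_pM2l// /W lerDr.
  by rewrite mulr_ge0 ?sqr_ge0// mulr_ge0.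
have := head_tail_bound n0 hm r0 V0 t0 mu0 yh ysamp Phi Psi AyW.
have := sqn_split (c *: x) y; rewrite cx -/C -/W.
have nR : 0 < n%:R :> R by rewrite ltr0n.
have r2 : 0 < r ^+ 2 by rewrite exprn_gt0.
rewrite ltr_pdivlMr// => e1 e2.
have e3 : 16 * C * h%:R * r ^+ 2 <= n%:R * r ^+ 2 by rewrite ler_pM2r.
have e4 : r ^+ 2 * n%:R <= (2 * (r ^+ 2 / 8) + 2 * sqn y) * n%:R.
  by rewrite ler_pM2r//; lra.
have e5 : 0 < r ^+ 2 * n%:R by rewrite mulr_gt0.
rewrite /W in e2; lra.
Qed.

(** * The two families of ellipsoids *)

Section Entropy.
Context {R : realType} {d : measure_display} {T : measurableType d}.
Variable P : probability T R.
Context {n m : nat} (G : 'I_n -> 'I_m -> {RV P >-> R}).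
Hypotheses (hG : std_gaussian_matrix G) (n0 : (0 < n)%N).

Lemma lnplus_2M (x : R) : 0 <= x -> lnplus (2 * x) <= 1 + lnplus x.
Proof.
move=> x0; rewrite -ler_expR expRD !expR_lnplus.
have e2 : 2 <= expR 1 :> R by apply: le_trans (expR_ge1Dx _); rewrite -natr1.
have m1 : 1 <= Num.max 1 x by rewrite le_max lexx.
have mx : x <= Num.max 1 x by rewrite le_max lexx orbT.
have m2 : 2 * Num.max 1 x <= expR 1 * Num.max 1 x by rewrite ler_pM2r//; lra.
rewrite ge_max; apply/andP; split; lra.
Qed.

(** The sets sampled with a constant step: [x] is described by its density
    [|x i| / (W la i)] with respect to the probability weights [la] on the tail, and
    both its mass and its entropy are bounded. The step [4 q W] divides the entropy
    [q] by [4 q] and brings the variance to [8 q W ^ 2]. *)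
Lemma entropy_radius (K : set 'cV[R]_m) (h : nat) (q W : R) (la : 'I_m -> R) :
  (h <= m)%N -> 1 <= q <= n%:R -> 0 < W -> (forall i, 0 < la i) ->
  \sum_(i < m | (h <= i)%N) la i <= 1 ->
  16 * radius_const * h%:R <= n%:R :> R ->
  (forall (c : R) x, K x -> 0 <= c <= 1 -> K (c *: x)) ->
  (forall x, K x -> \sum_(i < m | (h <= i)%N) `|x i 0| <= 2 * W) ->
  (forall x, K x ->
     \sum_(i < m | (h <= i)%N) `|x i 0| * lnplus (`|x i 0| / (W * la i)) <= q * W) ->
  exists Om : set T, [/\ measurable Om, ((1 - 2 * expR (- n%:R))%:E <= P Om)%E &
    forall w, Om w -> forall x, K x -> gaussian_mx G w *m x = 0 ->
      sqn x <= 64 * radius_const * q * W ^+ 2 / n%:R].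
Proof.
move=> hm /andP[q1 qn] W0 la0 la1 hn Kstar Kmass Kent.
have q0 : 0 < q by lra.
have nR : 0 < n%:R :> R by rewrite ltr0n.
have nR1 : 1 <= n%:R :> R by rewrite ler1n.
have C8 := @radius_const_ge R; set C := radius_const in hn C8 *.
have rr0 : 0 < 64 * C * q * W ^+ 2 / n%:R.
  by rewrite divr_gt0// !mulr_gt0// ?exprn_gt0//; lra.
pose r := Num.sqrt (64 * C * q * W ^+ 2 / n%:R).
have r2 : r ^+ 2 = 64 * C * q * W ^+ 2 / n%:R by rewrite sqr_sqrtr// ltW.
rewrite -r2.
apply: (@kernel_radius _ _ _ _ _ _ G K h r (8 * q * W ^+ 2) (fun=> 4 * q * W)
   (fun i => la i / 2)) => //.
- by rewrite sqrtr_gt0.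
- by rewrite !mulr_gt0 ?exprn_gt0.
- by move=> _; rewrite !mulr_gt0.
- by move=> i; rewrite divr_gt0.
- by rewrite -mulr_suml ler_pdivrMr// mulVf.
- by rewrite r2 [n%:R * _]mulrC divfK ?gt_eqF// -/C; lra.
move=> A x Aphi Kx Ax; exists x; split => //; last 2 first.
- by rewrite subrr sqn0 divr_ge0// sqr_ge0.
- by rewrite Ax sqn0 ltW// !mulr_gt0 ?exprn_gt0.
have z0 i : 0 <= `|x i 0| / (W * la i) by rewrite divr_ge0// mulr_ge0// ltW.
have t0 : 0 < 4 * q * W by rewrite !mulr_gt0.
have mass := Kmass _ Kx; have ent := Kent _ Kx.
set M := \sum_(i < m | _) _ in mass; set E := \sum_(i < m | _) _ in ent.
split.
- rewrite -mulr_suml -/M ler_pdivrMr//; nra.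
- apply: (@le_trans _ _ ((4 * q * W)^-1 * (M + E))).
    rewrite /M /E -big_split /= mulr_sumr; apply: ler_sum => i _.
    rewrite [`|x i 0| / _]mulrC -[leLHS]mulrA ler_pM2l ?invr_gt0//.
    rewrite -[X in _ <= X + _]mulr1 -mulrDr; apply: ler_wpM2l => //.
    apply: le_trans (lnplus_2M (z0 i)); apply: ler_lnplus.
    rewrite (_ : 4 * _ / _ = (2 * (`|x i 0| / (W * la i))) / q); last first.
      by have l0 := la0 i; field; rewrite !gt_eqF.
    by rewrite ler_pdivrMr// ler_peMr// mulr_ge0.
  by rewrite mulrC ler_pdivrMr//; nra.
- by rewrite -mulr_suml -/M; nra.
- have a0 i : 0 <= `|x i 0| / W by rewrite divr_ge0// ltW.
  have w0 i : 0 < la i / 2 by rewrite divr_gt0.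
  have := @young_sum R n m (fun i : 'I_m => (h <= i)%N) _ _ _ a0 w0 Aphi.
  have -> : \sum_(i < m | (h <= i)%N) `|x i 0| * (4 * q * W) * sqn (A *m delta_mx i 0) =
    16 * q * W ^+ 2 * \sum_(i < m | (h <= i)%N) `|x i 0| / W * (sqn (A *m delta_mx i 0) / 4).
    by rewrite mulr_sumr; apply: eq_bigr => i _; field; rewrite gt_eqF.
  set S := \sum_(i < m | _) _ * (_ / 4); rewrite -mulr_suml -/M.
  have : \sum_(i < m | (h <= i)%N) `|x i 0| / W * lnplus (`|x i 0| / W / (la i / 2)) <= 2 + q.
    apply: (@le_trans _ _ (W^-1 * (M + E))).
      rewrite /M /E -big_split /= mulr_sumr; apply: ler_sum => i _.
      rewrite [`|x i 0| / W]mulrC -[leLHS]mulrA ler_pM2l ?invr_gt0//.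
      rewrite -[X in _ <= X + _]mulr1 -mulrDr; apply: ler_wpM2l => //.
      apply: le_trans (lnplus_2M (z0 i)); apply: ler_lnplus.
      rewrite le_eqVlt; apply/orP; left; apply/eqP.
      by have l0 := la0 i; field; rewrite !gt_eqF.
    by rewrite mulrC ler_pdivrMr//; lra.
  have : M / W <= 2 by rewrite ler_pdivrMr//; lra.
  move=> hM hE hS; have S8 : S <= 8 * n%:R.
    have : 2 * n%:R * (M / W) <= 2 * n%:R * 2 by rewrite ler_pM2l//; lra.
    lra.
  have : 16 * q * W ^+ 2 * S <= 16 * q * W ^+ 2 * (8 * n%:R).
    by rewrite ler_pM2l// !mulr_gt0 ?exprn_gt0.
  have : 0 < q * W ^+ 2 * n%:R by rewrite !mulr_gt0 ?exprn_gt0.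
  lra.
Qed.

End Entropy.

Section WeightedL1.
Context {R : realType} {d : measure_display} {T : measurableType d}.
Variable P : probability T R.
Context {n m : nat} (G : 'I_n -> 'I_m -> {RV P >-> R}).
Hypotheses (hG : std_gaussian_matrix G) (n0 : (0 < n)%N).

Definition log_weight (i : nat) : R := ln i.+1%:R + 1.

Lemma log_weight_ge1 i : 1 <= log_weight i.
Proof. by rewrite /log_weight lerDr ln_ge0// ler1n. Qed.

Definition harmonic_prior (i : nat) : R := (2 * (i.+1%:R * i.+2%:R))^-1.

Lemma harmonic_prior_gt0 i : 0 < harmonic_prior i.
Proof. by rewrite invr_gt0 !mulr_gt0// ltr0n. Qed.

Lemma sum_harmonic_prior k : \sum_(i < k) harmonic_prior i <= 2^-1.
Proof.
suff -> : \sum_(i < k) harmonic_prior i = 2^-1 * (1 - k.+1%:R^-1).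
  by rewrite ler_piMr// lerBlDr lerDl.
elim: k => [|k IH]; first by rewrite big_ord0 invr1 subrr mulr0.
rewrite big_ord_recr /= IH /harmonic_prior.
have x0 : 0 < k.+1%:R :> R by rewrite ltr0n.
rewrite -[k.+2%:R]natr1; set x : R := k.+1%:R in x0 *.
by field; rewrite !gt_eqF//; lra.
Qed.

(** The entropy of drawing coordinate [i] is of the order of [log_weight i]: this is
    the logarithm in the bound for [p = 1]. *)
Lemma inv_harmonic_prior_le i :
  4 / harmonic_prior i <= expR (5 * log_weight i).
Proof.
rewrite invrK.
have i1 : i.+2%:R <= 2 * i.+1%:R :> R.
  by rewrite -natrM ler_nat mul2n doubleS !ltnS -addnn leq_addl.
have i0 : 0 < i.+1%:R :> R by rewrite ltr0n.
have e2 : 2 <= expR 1 :> R by apply: le_trans (expR_ge1Dx _); rewrite -natr1.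
have e4 : 2 ^+ 4 <= expR 1 ^+ 4 :> R by apply: lerXn2r; rewrite ?nnegrE ?expR_ge0.
have L1 := log_weight_ge1 i.
have lnE : expR (2 * ln i.+1%:R) = i.+1%:R ^+ 2 :> R.
  by rewrite expRM_natl lnK.
apply: (@le_trans _ _ (expR (4 + 2 * ln i.+1%:R))); last first.
  by rewrite ler_expR; move: L1; rewrite /log_weight; lra.
have -> : expR (4 + 2 * ln i.+1%:R) = expR 1 ^+ 4 * i.+1%:R ^+ 2 :> R.
  by rewrite expRD lnE -expRM_natl mulr1.
apply: (@le_trans _ _ (2 ^+ 4 * i.+1%:R ^+ 2)); last by rewrite ler_pM2r// exprn_gt0.
rewrite !exprS expr0.
have : i.+1%:R * i.+2%:R <= i.+1%:R * (2 * i.+1%:R) :> R by rewrite ler_pM2l.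
lra.
Qed.

(** The weights may add up to less than one: the missing mass sits at the origin. *)
Lemma jensen_sqr (I : finType) (la c : I -> R) : (forall i, 0 <= la i) ->
  \sum_i la i <= 1 -> (\sum_i la i * c i) ^+ 2 <= \sum_i la i * c i ^+ 2.
Proof.
move=> la0 la1; set s := \sum_i la i * c i.
have : 0 <= \sum_i la i * (c i - s) ^+ 2.
  by apply: sumr_ge0 => i _; rewrite mulr_ge0 ?sqr_ge0.
have -> : \sum_i la i * (c i - s) ^+ 2 =
    \sum_i la i * c i ^+ 2 - 2 * s * s + s ^+ 2 * \sum_i la i.
  rewrite (eq_bigr (fun i => la i * c i ^+ 2 + (- (2 * s) * (la i * c i) + s ^+ 2 * la i))).
    by rewrite !big_split /= -!mulr_sumr -/s mulNr addrA.
  by move=> i _; ring.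
have : s ^+ 2 * \sum_i la i <= s ^+ 2 by rewrite ler_piMr// sqr_ge0.
lra.
Qed.

(** Jensen's inequality for the squared norm, [b] being a convex combination of the
    origin and of the vertices [+- s i e_i]. *)
Lemma cross_polytope_image k (s : 'I_m -> R) (A : 'M[R]_(k, m)) (b : 'cV[R]_m) :
  (forall i, 0 < s i) -> \sum_i `|b i 0| / s i <= 1 ->
  sqn (A *m b) <= \sum_i `|b i 0| * s i * sqn (A *m delta_mx i 0).
Proof.
move=> s0 b1; rewrite /sqn.
under [leRHS]eq_bigr do rewrite mulr_sumr.
rewrite exchange_big /=; apply: ler_sum => j _.
rewrite mxE.
have -> : \sum_i A j i * b i 0 = \sum_i `|b i 0| / s i * (Num.sg (b i 0) * s i * A j i).
  apply: eq_bigr => i _; rewrite [in LHS](numEsg (b i 0)).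
  by field; rewrite gt_eqF.
apply: (le_trans (jensen_sqr _ _ b1)); first by move=> i; rewrite divr_ge0// ltW.
apply: ler_sum => i _.
have -> : (A *m (delta_mx i 0 : 'cV_m)) j 0 = A j i by rewrite -colE mxE.
rewrite !exprMn sqr_sg.
have [->|_] := eqVneq (b i 0) 0; first by rewrite normr0 !mul0r.
by rewrite mul1r le_eqVlt; apply/orP; left; apply/eqP; field; rewrite gt_eqF.
Qed.

(** The step [4 s i log_weight i] makes the entropy of each coordinate proportional to
    its mass [|x i| / s i] and the variance at most [4 M ^ 2]. *)
Lemma weighted_l1_radius (h : nat) (s : 'I_m -> R) (M : R) :
  (h <= m)%N -> (forall i, 0 < s i) -> 0 < M ->
  (forall i : 'I_m, (h <= i)%N -> s i ^+ 2 * log_weight i <= M ^+ 2) ->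
  16 * radius_const * h%:R <= n%:R :> R ->
  exists Om : set T, [/\ measurable Om, ((1 - 2 * expR (- n%:R))%:E <= P Om)%E &
    forall w, Om w -> forall x : 'cV[R]_m, \sum_i `|x i 0| / s i <= 1 ->
      gaussian_mx G w *m x = 0 -> sqn x <= 64 * radius_const * M ^+ 2 / n%:R].
Proof.
move=> hm s0 M0 sM hn.
have nR : 0 < n%:R :> R by rewrite ltr0n.
have nR1 : 1 <= n%:R :> R by rewrite ler1n.
have C8 := @radius_const_ge R; set C := radius_const in hn C8 *.
have M2 : 0 < M ^+ 2 by rewrite exprn_gt0.
have rr0 : 0 < 64 * C * M ^+ 2 / n%:R by rewrite divr_gt0// !mulr_gt0//; lra.
pose r := Num.sqrt (64 * C * M ^+ 2 / n%:R).
have r2 : r ^+ 2 = 64 * C * M ^+ 2 / n%:R by rewrite sqr_sqrtr// ltW.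
have L1 := log_weight_ge1.
have L0 i : 0 < log_weight i by rewrite (lt_le_trans _ (L1 i)).
rewrite -r2.
apply: (@kernel_radius _ _ _ _ _ _ G [set x | \sum_i `|x i 0| / s i <= 1] h r
   (4 * M ^+ 2) (fun i => 4 * s i * log_weight i) harmonic_prior) => //.
- by rewrite sqrtr_gt0.
- by rewrite mulr_gt0.
- by move=> i; rewrite !mulr_gt0.
- by move=> i; exact: harmonic_prior_gt0.
- apply: le_trans (sum_harmonic_prior m).
  rewrite [leRHS](sum_head_tail h) lerDr sumr_ge0// => i _.
  exact/ltW/harmonic_prior_gt0.
- have : 0 <= C * M ^+ 2 by rewrite mulr_ge0 ?(ltW M2)//; lra.
  by rewrite r2 [n%:R * _]mulrC divfK ?gt_eqF// -/C; lra.
- move=> c x /= Kx /andP[c0 c1]; apply: le_trans Kx; apply: ler_sum => i _.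
  rewrite mxE normrM (ger0_norm c0) -mulrA ler_piMl//.
  by rewrite divr_ge0// ltW.
move=> A x Aphi /= Kx Ax.
have image_le (i : 'I_m) : (h <= i)%N -> sqn (A *m delta_mx i 0) <= 8 * n%:R + 20 * log_weight i.
  move=> hi; have := Aphi; rewrite (bigD1 i)//= => Aphi'.
  have : harmonic_prior i * expR (sqn (A *m delta_mx i 0) / 4) <= expR (2 * n%:R).
    apply: le_trans Aphi'; rewrite lerDl sumr_ge0// => j _.
    by rewrite mulr_ge0 ?expR_ge0// ltW// harmonic_prior_gt0.
  have p0 := harmonic_prior_gt0 i.
  rewrite -ler_pdivlMl// => le1.
  have : expR (sqn (A *m delta_mx i 0) / 4) <= expR (5 * log_weight i + 2 * n%:R).
    apply: (le_trans le1); rewrite expRD ler_pM2r ?expR_gt0//.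
    apply: le_trans (inv_harmonic_prior_le i); rewrite ler_peMl ?invr_ge0 ?(ltW p0)//.
    lra.
  by rewrite ler_expR ler_pdivrMr//; lra.
(* The columns of a far coordinate may be much longer than [sqrt n]. *)
pose near i := (i < h)%N || (log_weight i <= n%:R).
pose y : 'cV[R]_m := \col_i (if near i then x i 0 else 0).
have yE i : `|y i 0| <= `|x i 0| by rewrite mxE; case: ifP => // _; rewrite normr0.
have xyE i : `|(x - y) i 0| <= `|x i 0|.
  by rewrite !mxE; case: ifP; rewrite ?subrr ?normr0 ?subr0.
have mass0 i : 0 <= `|x i 0| / s i by rewrite divr_ge0// ltW.
have tail_mass : \sum_(i < m | (h <= i)%N) `|x i 0| / s i <= 1.
  apply: le_trans Kx; rewrite [leRHS](sum_head_tail h) lerDr sumr_ge0//.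
have mass1 i : `|x i 0| / s i <= 1.
  by apply: le_trans Kx; rewrite (bigD1 i)//= lerDl sumr_ge0.
have far_mass : \sum_i `|(x - y) i 0| / s i <= 1.
  by apply: le_trans Kx; apply: ler_sum => i _; rewrite ler_pM2r ?invr_gt0.
have s2M (i : 'I_m) : (h <= i)%N -> `|x i 0| * s i * log_weight i <= `|x i 0| / s i * M ^+ 2.
  move=> hi; rewrite (_ : _ * _ * _ = `|x i 0| / s i * (s i ^+ 2 * log_weight i)).
    by apply: ler_wpM2l => //; exact: sM.
  by field; rewrite gt_eqF.
exists y; split.
- by move=> i ih; rewrite mxE /near ih.
- split.
  + apply: (@le_trans _ _ (\sum_(i < m | (h <= i)%N) 4^-1 * (`|x i 0| / s i))).
      apply: ler_sum => i _.
      rewrite (_ : _ / (4 * s i * log_weight i) = 4^-1 * ((`|y i 0| / s i) / log_weight i)).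
        rewrite ler_pM2l ?invr_gt0// ler_pdivrMr//.
        apply: (@le_trans _ _ (`|x i 0| / s i)); first by rewrite ler_pM2r ?invr_gt0.
        by rewrite ler_peMr.
      by field; rewrite !gt_eqF.
    rewrite -mulr_sumr; lra.
  + apply: (@le_trans _ _ (\sum_(i < m | (h <= i)%N) 2 * (`|x i 0| / s i)));
      last by rewrite -mulr_sumr; lra.
    apply: ler_sum => i hi.
    pose nu := `|y i 0| / (4 * s i * log_weight i).
    have nu_le : nu * log_weight i <= 4^-1 * (`|x i 0| / s i).
      rewrite (_ : nu * log_weight i = 4^-1 * (`|y i 0| / s i)); last first.
        by rewrite /nu; field; rewrite !gt_eqF.
      by rewrite ler_pM2l ?invr_gt0// ler_pM2r ?invr_gt0.
    have nu0 : 0 <= nu by rewrite divr_ge0// ltW// !mulr_gt0.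
    have nu1 : nu <= 1.
      have : nu <= nu * log_weight i by rewrite ler_peMr.
      have := mass1 i; lra.
    have : lnplus (4 * nu / harmonic_prior i) <= 5 * log_weight i.
      rewrite -ler_expR expR_lnplus ge_max; apply/andP; split.
        by rewrite -[leLHS]expR0 ler_expR mulr_ge0 ?(ltW (L0 i)).
      apply: le_trans (inv_harmonic_prior_le i).
      by rewrite ler_pM2r ?invr_gt0 ?harmonic_prior_gt0// ler_piMr.
    by move=> /(ler_wpM2l nu0); have := mass0 i; rewrite -/nu; lra.
  + apply: (@le_trans _ _ (\sum_(i < m | (h <= i)%N) `|x i 0| / s i * (4 * M ^+ 2))).
      apply: ler_sum => i hi; have := s2M i hi.
      have : `|y i 0| * (4 * s i * log_weight i) <= `|x i 0| * (4 * s i * log_weight i).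
        by rewrite ler_pM2r// !mulr_gt0.
      lra.
    by rewrite -mulr_suml ler_piMl//; lra.
  + apply: (@le_trans _ _ (\sum_(i < m | (h <= i)%N) `|x i 0| / s i * (n%:R * (32 * (4 * M ^+ 2))))).
      apply: ler_sum => i hi; rewrite mxE /near ltnNge hi /=.
      case: (leP (log_weight i) n%:R) => [Ln|_]; last first.
        rewrite normr0 !mul0r; apply: mulr_ge0 => //.
        by rewrite !mulr_ge0// ltW.
      have h1 := image_le i hi; have h2 := s2M i hi.
      have h3 : sqn (A *m delta_mx i 0) <= 28 * n%:R by lra.
      have a0 : 0 <= `|x i 0| * (4 * s i * log_weight i).
        by rewrite mulr_ge0// ltW// !mulr_gt0.
      have := ler_wpM2l a0 h3.
      have := mulr_ge0 (mass0 i) (ltW M2).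
      have := ler_wpM2r (ltW nR) h2.
      have : 0 <= `|x i 0| / s i * M ^+ 2 * n%:R.
        by rewrite mulr_ge0 ?(ltW nR)// mulr_ge0// ltW.
      lra.
    rewrite -mulr_suml ler_piMl// mulr_ge0 ?(ltW nR)//; lra.
- have : sqn (x - y) <= \sum_i `|(x - y) i 0| * s i * sqn (1%:M *m (delta_mx i 0 : 'cV_m)).
    by rewrite -{1}[x - y]mul1mx; exact: cross_polytope_image.
  move=> /le_trans; apply.
  apply: (@le_trans _ _ (\sum_i `|(x - y) i 0| / s i * (M ^+ 2 / n%:R))).
    apply: ler_sum => i _; rewrite mul1mx sqn_delta mulr1 !mxE /near.
    case: ifPn => [_|]; first by rewrite subrr normr0 !mul0r.
    rewrite negb_or -leqNgt -ltNge subr0 => /andP[hi Li].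
    have h2 := s2M i hi.
    rewrite mulrA ler_pdivlMr//; apply: le_trans h2.
    by rewrite ler_wpM2l ?(ltW Li)// mulr_ge0// ltW.
  rewrite -mulr_suml r2 (le_trans (ler_piMl _ far_mass))//.
    by rewrite divr_ge0 ?ltW.
  rewrite (_ : 64 * C * M ^+ 2 / n%:R / 8 = 8 * C * (M ^+ 2 / n%:R)); last first.
    by field; rewrite gt_eqF.
  by rewrite ler_peMl ?divr_ge0 ?(ltW nR) ?(ltW M2)//; lra.
- have -> : A *m y = - (A *m (x - y)) by rewrite mulmxBr Ax sub0r opprK.
  rewrite -scaleN1r sqnZ sqrrN expr1n mul1r.
  apply: (le_trans (cross_polytope_image A s0 far_mass)).
  apply: (@le_trans _ _ (\sum_i `|(x - y) i 0| / s i * (28 * M ^+ 2))).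
    apply: ler_sum => i _; rewrite !mxE /near.
    case: ifPn => [_|]; first by rewrite subrr normr0 !mul0r.
    rewrite negb_or -leqNgt -ltNge subr0 => /andP[hi Li].
    have h1 := image_le i hi; have h2 := s2M i hi.
    have h3 : sqn (A *m delta_mx i 0) <= 28 * log_weight i by lra.
    have a0 : 0 <= `|x i 0| * s i by rewrite mulr_ge0// ltW.
    have := ler_wpM2l a0 h3; lra.
  rewrite -mulr_suml (le_trans (ler_piMl _ far_mass))//; lra.
Qed.

End WeightedL1.

Section EllipsoidFacts.
Context {R : realType}.

Lemma ellipsoid_solid (p : \bar R) (sigma : nat -> R) m (x y : 'cV[R]_m) :
  (1 <= p)%E -> (forall j, (1 <= j)%N -> 0 < sigma j) ->
  ellipsoid p sigma m x -> (forall i, `|y i 0| <= `|x i 0|) ->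
  ellipsoid p sigma m y.
Proof.
move=> p1 s0 + yx.
rewrite /ellipsoid; case: ifP => py /=.
  move=> /bigmax_leP[_ H]; apply/bigmax_leP; split => // i _.
  by apply: le_trans (H i isT); rewrite ler_pM2r ?invr_gt0 ?s0.
move=> H; apply: le_trans H; apply: ler_sum => i _.
rewrite ler_pM2r ?invr_gt0 ?powR_gt0 ?s0//.
apply: ge0_ler_powR; rewrite ?nnegrE//.
by rewrite fine_ge0// (le_trans _ p1).
Qed.

Lemma ellipsoid_star (p : \bar R) (sigma : nat -> R) m (c : R) (x : 'cV[R]_m) :
  (1 <= p)%E -> (forall j, (1 <= j)%N -> 0 < sigma j) ->
  ellipsoid p sigma m x -> 0 <= c <= 1 -> ellipsoid p sigma m (c *: x).
Proof.
move=> p1 s0 Kx /andP[c0 c1]; apply: (ellipsoid_solid p1 s0 Kx) => i.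
by rewrite mxE normrM (ger0_norm c0) ler_piMl.
Qed.

Lemma ellipsoid_coord_le (p : \bar R) (sigma : nat -> R) m (x : 'cV[R]_m) i :
  (1 <= p)%E -> (forall j, (1 <= j)%N -> 0 < sigma j) ->
  ellipsoid p sigma m x -> `|x i 0| <= sigma i.+1.
Proof.
move=> p1 s0; have si := s0 i.+1 isT.
rewrite /ellipsoid; case: ifP => py /=.
  by move=> /bigmax_leP[_ /(_ i isT)]; rewrite ler_pdivrMr ?mul1r.
move=> H; have p0 : 0 < fine p.
  by case: p p1 py {H} => [a| |]//; rewrite lee_fin => /(lt_le_trans ltr01).
rewrite leNgt; apply/negP => lt_sx.
have : `|x i 0| `^ fine p / sigma i.+1 `^ fine p <= 1.
  apply: le_trans H; rewrite [leRHS](bigD1 i)//= lerDl sumr_ge0// => j _.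
  by rewrite divr_ge0 ?powR_ge0.
rewrite ler_pdivrMr ?powR_gt0// mul1r leNgt => /negP; apply.
by apply: gt0_ltr_powR; rewrite ?nnegrE ?(ltW si).
Qed.

Lemma mulr_lnplus_le (a z : R) : 1 < a -> 0 <= z -> z * lnplus z <= z `^ a / (a - 1).
Proof.
move=> a1 z0; have a10 : 0 < a - 1 by rewrite subr_gt0.
have [z1|z1] := leP z 1.
  by rewrite /lnplus max_l// ln1 mulr0 divr_ge0 ?powR_ge0// ltW.
rewrite /lnplus max_r ?(ltW z1)// ler_pdivlMr//.
rewrite -mulrA -(mulr_powRB1 z0) ?(lt_trans ltr01)// ler_wpM2l//.
rewrite mulrC -ln_powR ltW// ln_sublinear// powR_gt0//; lra.
Qed.

Lemma le_1_powR (a z : R) : 1 < a -> 0 <= z -> z <= 1 + z `^ a.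
Proof.
move=> a1 z0; have [z1|z1] := leP z 1; first by rewrite (le_trans z1)// lerDl powR_ge0.
by rewrite (le_trans (le1r_powR (ltW z1) (ltW a1)))// lerDr.
Qed.

Lemma conj_expE (a : R) : 1 < a -> conj_exp a%:E = a / (a - 1).
Proof.
move=> a1; rewrite /conj_exp /hoelder_conjugate /= eqe gt_eqF; last by lra.
by rewrite -EFinB inver gt_eqF ?subr_gt0//.
Qed.

Lemma conj_expy : conj_exp (+oo : \bar R)%E = 1.
Proof. by rewrite /conj_exp hoelder_conjugatey. Qed.

Lemma conj_exp_ge1 (p : \bar R) : (1 < p)%E -> 1 <= conj_exp p.
Proof.
case: p => [a|_|]; [|by rewrite conj_expy|by rewrite ltNge leNye].
rewrite lte_fin => a1; rewrite conj_expE// ler_pdivlMr ?subr_gt0//; lra.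
Qed.

(** The reference weights [la] are those for which Hoelder's inequality is sharp;
    measuring [x] by its density [z] with respect to them turns the ellipsoid into
    a bound [sum la * z ^ p <= 1], or [z <= 1] if [p] is infinite. *)
Lemma ellipsoid_tail (p : \bar R) (sigma : nat -> R) m h (x : 'cV[R]_m) :
  let q := conj_exp p in
  let S := \sum_(i < m | (h <= i)%N) sigma i.+1 `^ q in
  let W := S `^ q^-1 in let la (i : 'I_m) := sigma i.+1 `^ q / S in
  (1 < p)%E -> (forall j, (1 <= j)%N -> 0 < sigma j) -> 0 < S ->
  ellipsoid p sigma m x ->
  \sum_(i < m | (h <= i)%N) `|x i 0| <= 2 * W /\
  \sum_(i < m | (h <= i)%N) `|x i 0| * lnplus (`|x i 0| / (W * la i)) <= q * W.
Proof.
move=> q S W la p1 s0 S0 Kx.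
have la1 : \sum_(i < m | (h <= i)%N) la i = 1 by rewrite -mulr_suml divff// gt_eqF.
have W0 : 0 < W by rewrite powR_gt0.
have la0 i : 0 < la i by rewrite divr_gt0// powR_gt0// s0.
have q1 : 1 <= q by exact: conj_exp_ge1.
case: p p1 @q @S @W @la Kx S0 la1 W0 la0 q1 => [a| |] a1 q S W la Kx S0 la1 W0 la0 q1; last by rewrite ltNge leNye in a1.
  rewrite lte_fin in a1.
  have qE : q = a / (a - 1) by exact: conj_expE.
  pose z i := `|x i 0| / (W * la i).
  have z0 i : 0 <= z i by rewrite divr_ge0// mulr_ge0// ltW.
  have xE i : `|x i 0| = W * (la i * z i).
    by rewrite /z mulrA mulrC divfK// gt_eqF// mulr_gt0.
  pose u (i : 'I_m) := `|x i 0| `^ a / sigma i.+1 `^ a.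
  have u0 i : 0 <= u i by rewrite divr_ge0// powR_ge0.
  have uE i : la i * z i `^ a = u i.
    have si := s0 i.+1 isT.
    have wla0 : 0 <= (W * la i)^-1 by rewrite invr_ge0 ltW// mulr_gt0.
    rewrite /z powRM//.
    rewrite mulrCA /u; congr (_ * _).
    rewrite -(powR_inv1 (ltW (mulr_gt0 W0 (la0 i)))) /la /W.
    have sE : sigma i.+1 = expR (ln (sigma i.+1)) by rewrite lnK.
    have SE : S = expR (ln S) by rewrite lnK.
    set ls := ln (sigma i.+1) in sE *; set lS := ln S in SE *.
    have pE (y b : R) : expR y `^ b = expR (b * y).
      by rewrite /powR gt_eqF ?expR_gt0// expRK.
    rewrite SE sE !pE -!expRN -!expRD !pE -expRD; congr expR.
    by rewrite qE; field; rewrite !gt_eqF//; lra.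
  have sum_u : \sum_(i < m | (h <= i)%N) u i <= 1.
    apply: le_trans Kx; rewrite [leRHS](sum_head_tail h) lerDr sumr_ge0// => i _.
    exact: u0.
  split.
    apply: (@le_trans _ _ (\sum_(i < m | (h <= i)%N) W * (la i + u i))).
      apply: ler_sum => i _; rewrite xE -uE ler_pM2l//.
      by rewrite -[X in _ <= X + _]mulr1 -mulrDr ler_pM2l// le_1_powR.
    by rewrite -mulr_sumr big_split /= la1 mulrC ler_pM2r//; lra.
  apply: (@le_trans _ _ (\sum_(i < m | (h <= i)%N) W / (a - 1) * u i)).
    apply: ler_sum => i _; rewrite -/(z i) {1}xE -uE.
    rewrite -[W * (la i * z i) * _]mulrA -[la i * z i * _]mulrA.
    rewrite (_ : W / (a - 1) * _ = W * (la i * (z i `^ a / (a - 1)))); last first.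
      by field; lra.
    rewrite !ler_pM2l//; exact: mulr_lnplus_le.
  have c0 : 0 <= W / (a - 1) by rewrite divr_ge0 ?(ltW W0)// subr_ge0 ltW.
  rewrite -mulr_sumr; apply: (le_trans (ler_wpM2l c0 sum_u)).
  rewrite mulr1 [W / _]mulrC ler_pM2r// qE -[leLHS]mul1r ler_pM2r ?(ltW a1)//.
  by rewrite invr_gt0 subr_gt0.
have qE : q = 1 by exact: conj_expy.
have xs i : `|x i 0| <= sigma i.+1.
  move: Kx => /= /bigmax_leP[_ /(_ i isT)].
  by rewrite ler_pdivrMr ?mul1r// s0.
have WE i : W * la i = sigma i.+1.
  have si := s0 i.+1 isT.
  rewrite /W /la qE invr1 !powRr1 ?(ltW S0) ?(ltW si)//.
  by rewrite mulrC divfK// gt_eqF.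
split.
  apply: (@le_trans _ _ (\sum_(i < m | (h <= i)%N) W * la i)).
    by apply: ler_sum => i _; rewrite WE.
  by rewrite -mulr_sumr la1 mulr1; lra.
rewrite big1; first by rewrite mulr_ge0// ?(ltW W0)//; lra.
move=> i _; rewrite WE /lnplus max_l ?ln1 ?mulr0//.
by rewrite ler_pdivrMr ?mul1r// s0.
Qed.

End EllipsoidFacts.

(** * Measurability of the radius event *)

Section Measurability.
Context {d : measure_display} {T : measurableType d} {R : realType}.
Variable P : probability T R.
Context {n m : nat} (G : 'I_n -> 'I_m -> {RV P >-> R}).

(** This norm of [A x] is Lipschitz in [x] with the explicit constant of
    [rowsum_lipschitz]. *)
Definition rowsum (A : 'M[R]_(n, m)) (x : 'cV[R]_m) : R :=
  \sum_i `|(A *m x) i 0|.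

Lemma rowsum_ge0 A x : 0 <= rowsum A x.
Proof. by apply: sumr_ge0. Qed.

Lemma rowsum_eq0 A x : rowsum A x = 0 -> A *m x = 0.
Proof.
move=> /eqP; rewrite psumr_eq0// => /allP H; apply/colP => i.
by have := H i (mem_index_enum _); rewrite /= normr_eq0 => /eqP ->; rewrite [RHS]mxE.
Qed.

Lemma rowsum_lipschitz (A : 'M[R]_(n, m)) (x y : 'cV[R]_m) (e : R) :
  (forall j, `|x j 0 - y j 0| <= e) ->
  rowsum A x <= rowsum A y + (\sum_i \sum_j `|A i j|) * e.
Proof.
move=> xy; rewrite mulr_suml -big_split /=; apply: ler_sum => i _.
have -> : (A *m x) i 0 = (A *m y) i 0 + \sum_j A i j * (x j 0 - y j 0).
  by rewrite !mxE -big_split /=; apply: eq_bigr => j _; rewrite mulrBr addrC subrK.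
apply: (le_trans (ler_normD _ _)); rewrite lerD2l mulr_suml.
apply: (le_trans (ler_norm_sum _ _ _)); apply: ler_sum => j _.
by rewrite normrM ler_wpM2l.
Qed.

Lemma measurable_rowsum_lt (x : 'cV[R]_m) (c : R) :
  measurable [set w | rowsum (gaussian_mx G w) x < c].
Proof.
have mf : measurable_fun setT (fun w => (rowsum (gaussian_mx G w) x)%:E).
  apply/measurable_EFinP; apply: measurable_sum => i.
  apply: measurableT_comp => //; under eq_fun do rewrite mxE.
  apply: measurable_sum => j; under eq_fun do rewrite mxE.
  by apply: measurable_funM.
rewrite (_ : [set _ | _] = ~` ([set: T] `&` [set w | (c%:E <= (rowsum (gaussian_mx G w) x)%:E)%E])).
  by apply: measurableC; exact: emeasurable_fun_c_infty.
rewrite setTI; apply/seteqP; split => w /=; rewrite lee_fin ltNge; first by move/negP.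
by move=> h; apply/negP.
Qed.

(** Failure means that some [x] of the set with [sqn x > c2] lies in the kernel. The
    witness is replaced by rational points near the set that are almost in the
    kernel, which makes the union countable. Conversely, approximate witnesses
    accumulate at a kernel point, and an arbitrarily small contraction of it is
    dominated coordinatewise by points of the set. *)
Lemma measurable_kernel_radius (K : set 'cV[R]_m) (M c2 : R) : 0 <= c2 ->
  (forall x, K x -> forall i, `|x i 0| <= M) ->
  (forall x y : 'cV[R]_m, K x -> (forall i, `|y i 0| <= `|x i 0|) -> K y) ->
  measurable [set w | forall x, K x -> gaussian_mx G w *m x = 0 -> sqn x <= c2].
Proof.
move=> c20 KM Ksolid.
pose Q (q : 'cV[rat]_m) : 'cV[R]_m := map_mx ratr q.
pose near_K j l (q : 'cV[rat]_m) := exists2 x, K x /\ c2 + j.+1%:R^-1 <= sqn x &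
  forall i, `|x i 0 - Q q i 0| <= l.+1%:R^-1.
pose cell j l (k : nat) : set T :=
  if (unpickle k : option 'cV[rat]_m) is Some q then
    if `[< near_K j l q >] then [set w | rowsum (gaussian_mx G w) (Q q) < l.+1%:R^-1] else set0
  else set0.
have mcell j l k : measurable (cell j l k).
  rewrite /cell; case: unpickle => // q; case: ifP => // _.
  exact: measurable_rowsum_lt.
suff -> : [set w | forall x, K x -> gaussian_mx G w *m x = 0 -> sqn x <= c2] =
    ~` \bigcup_j \bigcap_l \bigcup_k cell j l k.
  apply: measurableC; apply: bigcupT_measurable => j; apply: bigcapT_measurable => l.
  exact: bigcupT_measurable.
apply/seteqP; split => [w good [j _ badw]|w nbad x Kx Ax]; last first.
  rewrite leNgt; apply/negP => cx; apply: nbad.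
  have /ltr_add_invr[j jx] := cx.
  exists j => // l _; set A := gaussian_mx G w in Ax *.
  pose S := \sum_i \sum_j `|A i j|.
  have S0 : 0 <= S by do 2 apply: sumr_ge0 => ? _.
  have l0 : 0 < l.+1%:R^-1 :> R by rewrite invr_gt0 ltr0n.
  pose e := l.+1%:R^-1 / (S + 1).
  have e0 : 0 < e by rewrite divr_gt0// ltr_wpDl.
  have el : e <= l.+1%:R^-1 by rewrite ler_pdivrMr ?ltr_wpDl// ler_peMr ?(ltW l0)// lerDr.
  have /choice[f fP] : forall i, exists r : rat, `|x i 0 - ratr r| <= e.
    move=> i; have /rat_in_itvoo[r] : x i 0 - e < x i 0 + e by lra.
    rewrite in_itv /= => /andP[r1 r2]; exists r.
    by rewrite ler_norml; apply/andP; split; lra.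
  pose q : 'cV[rat]_m := \col_i f i.
  exists (pickle q) => //; rewrite /cell pickleK.
  have xq i : `|x i 0 - Q q i 0| <= e by rewrite !mxE.
  rewrite ifT /=; last first.
    apply/asboolP; exists x; first by split => //; exact: ltW.
    by move=> i; exact: le_trans (xq i) el.
  have qx i : `|Q q i 0 - x i 0| <= e by rewrite distrC.
  have := rowsum_lipschitz A qx.
  have -> : rowsum A x = 0 by apply: big1 => i _; rewrite Ax mxE normr0.
  rewrite add0r -/S => /le_lt_trans; apply.
  by rewrite /e mulrA ltr_pdivrMr ?ltr_wpDl// mulrC ltr_pM2l// ltrDl.
set A := gaussian_mx G w; pose S := \sum_i \sum_j `|A i j|.
have S0 : 0 <= S by do 2 apply: sumr_ge0 => ? _.
(* Points [u.1] of the set and rational points [u.2], asymptotically in the kernel. *)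
have /choice[u uP] : forall l : nat, exists u : 'rV[R]_m * 'cV[R]_m,
    [/\ K u.1^T, c2 + j.+1%:R^-1 <= sqn u.1^T, rowsum A u.2 < l.+1%:R^-1 &
      forall i, `|u.1 0 i - u.2 i 0| <= l.+1%:R^-1].
  move=> l; have [k _] := badw l I; rewrite /cell; case: unpickle => // q.
  case: ifP => // /asboolP[x [Kx sx] xq] /= rq.
  exists (x^T, Q q); split => //=; rewrite ?trmxK// => i.
  by rewrite mxE.
pose F := (fun l => (u l).1) @ \oo.
pose box := [set v : 'rV[R]_m | forall i, v ord0 i \in `[- M, M]].
have cbox : compact box.
  apply: (@rV_compact _  _ (fun=> `[- M, M]%classic)) => _.
  exact: segment_compact.
have Fbox : F box.
  exists 0%N => // l _ i /=; rewrite in_itv /= -ler_norml.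
  by have [Ku _ _ _] := uP l; have := KM _ Ku i; rewrite mxE.
have [v [vbox vcl]] := cbox F _ Fbox.
have vlim (e : R) N : 0 < e -> exists l, (N <= l)%N /\
    forall i, `|(u l).1 0 i - v 0 i| < e.
  move=> e0.
  have FA : F [set (u l).1 | l in [set l | (N <= l)%N]].
    by exists N => // l Nl /=; exists l.
  have [_ [[l Nl <-] [_ B]]] := vcl _ _ FA (nbhsx_ballx v e e0).
  exists l; split => // i; have := B ord0 i.
  by rewrite /ball /= distrC.
have Av : A *m v^T = 0.
  apply: rowsum_eq0; apply/eqP; rewrite eq_le rowsum_ge0 andbT leNgt; apply/negP => rv.
  pose e := rowsum A v^T / (4 * (S + 1)).
  have S1 : 0 < S + 1 by rewrite ltr_wpDl.
  have e0 : 0 < e by rewrite divr_gt0// mulr_gt0.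
  have [N Ne] : exists N, N.+1%:R^-1 < e.
    by have /ltr_add_invr[N] := e0; rewrite add0r; exists N.
  have [l [Nl ul]] := vlim e N e0; have [_ _ rl uxl] := uP l.
  have le : l.+1%:R^-1 < e.
    by apply: le_lt_trans Ne; rewrite lef_pV2 ?posrE ?ltr0n// ler_nat.
  have vu i : `|v^T i 0 - (u l).2 i 0| <= 2 * e.
    rewrite mxE -[v 0 i](subrK ((u l).1 0 i)) -addrA.
    apply: (le_trans (ler_normD _ _)); have := ul i; rewrite distrC.
    have := uxl i => h1 h2; rewrite mulr_natl mulr2n.
    by apply: lerD; [exact: ltW | exact: le_trans h1 (ltW le)].
  have := rowsum_lipschitz A vu; rewrite -/S.
  have rE : rowsum A v^T = e * (4 * (S + 1)) by rewrite divfK// gt_eqF// mulr_gt0.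
  have : 0 <= S * e by rewrite mulr_ge0// ltW.
  have := lt_trans rl le; rewrite rE; lra.
have vM i : `|v 0 i| <= M by have := vbox i; rewrite /= in_itv /= -ler_norml.
have sv : c2 < sqn v^T.
  pose B := m%:R * (2 * `|M|); pose e := j.+1%:R^-1 / (B + 1).
  have B0 : 0 <= B by rewrite !mulr_ge0.
  have B1 : 0 < B + 1 by rewrite ltr_wpDl.
  have j0 : 0 < j.+1%:R^-1 :> R by rewrite invr_gt0 ltr0n.
  have e0 : 0 < e by rewrite divr_gt0.
  have [l [_ ul]] := vlim e 0%N e0; have [Kl sl _ _] := uP l.
  have : sqn (u l).1^T <= sqn v^T + \sum_(i < m) 2 * `|M| * e.
    rewrite /sqn -big_split /=; apply: ler_sum => i _; rewrite !mxE.
    have := KM _ Kl i; rewrite mxE => a1.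
    have a2 := vM i; have a3 := ltW (ul i); have a4 := ler_norm M.
    rewrite -lerBlDl subr_sqr; apply: (le_trans (ler_norm _)).
    rewrite normrM mulrC; apply: ler_pM => //.
    apply: (le_trans (ler_normD _ _)); rewrite mulr_natl mulr2n.
    by apply: lerD; [exact: le_trans a1 a4 | exact: le_trans a2 a4].
  have -> : \sum_(i < m) 2 * `|M| * e = B * e.
    by rewrite sumr_const card_ord /B -[LHS]mulr_natl mulrA.
  have : e * (B + 1) = j.+1%:R^-1 by rewrite divfK// gt_eqF.
  move: sl j0 e0; clear ul; clearbody e; move: (j.+1%:R^-1) (sqn (u l).1^T) => ij U; lra.
(* Any contraction factor [s < 1] with [c2 < s ^ 2 sqn v] would do. *)
pose s := Num.sqrt ((c2 + sqn v^T) / (2 * sqn v^T)).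
have v0 : 0 < sqn v^T by exact: le_lt_trans sv.
have s2 : s ^+ 2 = (c2 + sqn v^T) / (2 * sqn v^T).
  by rewrite sqr_sqrtr// divr_ge0 ?addr_ge0 ?mulr_ge0// ltW.
have s0 : 0 <= s by exact: sqrtr_ge0.
have s1 : s < 1.
  rewrite -sqrtr1 ltr_sqrt// ltr_pdivrMr ?mulr_gt0//; lra.
have [dl [dl0 dlP]] : exists dl : R, 0 < dl /\ forall i, v 0 i != 0 -> dl <= `|v 0 i|.
  exists (\big[Num.min/1]_(i | v 0 i != 0) `|v 0 i|); split.
    elim/big_ind : _ => //; first by move=> a b a0 b0; rewrite lt_min a0.
    by move=> i vi; rewrite normr_gt0.
  by move=> i vi; exact: bigmin_le_cond.
have s1' : 0 < 1 - s by rewrite subr_gt0.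
have [l [_ ul]] := vlim _ 0%N (mulr_gt0 s1' dl0).
have [Kl _ _ _] := uP l.
have Ksv : K (s *: v^T).
  apply: (Ksolid _ _ Kl) => i; rewrite !mxE normrM (ger0_norm s0).
  have [->|vi] := eqVneq (v 0 i) 0; first by rewrite normr0 mulr0.
  have h1 := ul i; have h2 := ler_wpM2l (ltW s1') (dlP i vi).
  have h3 := lerB_dist (v 0 i) ((u l).1 0 i); rewrite distrC in h1.
  have h4 := lt_le_trans (le_lt_trans h3 h1) h2.
  by move: h4; rewrite mulrBl mul1r ltrD2l ltrN2 => /ltW.
have := good _ Ksv; rewrite -scalemxAr Av scaler0 => /(_ erefl).
rewrite sqnZ s2 leNgt => /negP; apply.
rewrite mulrAC ltr_pdivlMr ?mulr_gt0//.
have : c2 * sqn v^T < sqn v^T * sqn v^T by rewrite ltr_pM2r.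
lra.
Qed.

End Measurability.

(** * The random section *)

Lemma sqn_le_l1 {R : realType} m (x : 'cV[R]_m) : sqn x <= (\sum_i `|x i 0|) ^+ 2.
Proof.
rewrite /sqn expr2 mulr_suml; apply: ler_sum => i _.
rewrite -real_normK ?num_real// expr2 ler_wpM2l//.
by rewrite (bigD1 i)//= lerDl sumr_ge0.
Qed.

Lemma big_nat_tail {R : realType} (F : nat -> R) h m :
  \sum_(h.+1 <= j < m.+1) F j = \sum_(i < m | (h <= i)%N) F i.+1.
Proof. by rewrite big_add1 /= big_geq_mkord. Qed.

Lemma section_rad_le {R : realType} m (K E : set 'cV[R]_m) (c : R) : 0 <= c ->
  (section_rad K E <= c%:E)%E <-> (forall x, K x -> E x -> sqn x <= c ^+ 2).
Proof.
move=> c0; split => [H x Kx iid_mean|H].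
  rewrite -norm2_le// -lee_fin; apply: le_trans H.
  by apply: ereal_sup_ubound; exists x.
by apply: ge_ereal_sup => _ [x [Kx iid_mean] <-]; rewrite lee_fin norm2_le//; exact: H.
Qed.

Lemma sqr_powR_Nhalf {R : realType} n : (0 < n)%N ->
  (n%:R `^ (- 2^-1)) ^+ 2 = n%:R^-1 :> R.
Proof. by move=> n0; rewrite powRN powR12_sqrt// exprVn sqr_sqrtr. Qed.

Section Radius.
Context {R : realType} {d : measure_display} {T : measurableType d}.
Variable P : probability T R.
Context {n m : nat} (G : 'I_n -> 'I_m -> {RV P >-> R}).
Hypotheses (hG : std_gaussian_matrix G) (n0 : (0 < n)%N).
Variable sigma : nat -> R.
Hypothesis s0 : forall j, (1 <= j)%N -> 0 < sigma j.
Variable h : nat.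
Hypotheses (hm : (h < m)%N) (hn : 16 * radius_const * h%:R <= n%:R :> R).

Let nR : 0 < n%:R :> R. Proof. by rewrite ltr0n. Qed.

(** For [q > n] there is no head, and the triangle inequality [|x| <= sum |x i| <= 2 W]
    is already stronger than the claim. *)
Lemma radius_conj (p : \bar R) : (1 < p)%E -> (n%:R < conj_exp p -> h = 0%N) ->
  let S := \sum_(i < m | (h <= i)%N) sigma i.+1 `^ conj_exp p in
  exists Om : set T, [/\ measurable Om, ((1 - 2 * expR (- n%:R))%:E <= P Om)%E &
    forall w, Om w -> forall x, ellipsoid p sigma m x -> gaussian_mx G w *m x = 0 ->
      sqn x <= 64 * radius_const * conj_exp p * (S `^ (conj_exp p)^-1) ^+ 2 / n%:R].
Proof.
move=> p1 h0 S; set q := conj_exp p; set W := S `^ q^-1.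
have q1 : 1 <= q by exact: conj_exp_ge1.
have S0 : 0 < S.
  rewrite /S (bigD1 (Ordinal hm))//= ltr_pwDl ?powR_gt0 ?s0// sumr_ge0// => i _.
  exact: powR_ge0.
have W0 : 0 < W by rewrite powR_gt0.
have tail x := @ellipsoid_tail R p sigma m h x p1 s0 S0.
have [qn|nq] := leP q n%:R; last first.
  exists setT; split => //.
    rewrite probability_setT lee_fin lerBlDr lerDl mulr_ge0 ?expR_ge0//.
  move=> w _ x Kx _; have [tail_mass _] := tail x Kx.
  have mass : \sum_i `|x i 0| <= 2 * W.
    apply: le_trans tail_mass; rewrite [leRHS](eq_bigl xpredT)// => i.
    by rewrite (h0 nq).
  apply: (le_trans (sqn_le_l1 x)).
  apply: (@le_trans _ _ ((2 * W) ^+ 2)).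
    have W2 : 0 <= 2 * W by rewrite mulr_ge0// ltW.
    have l10 : 0 <= \sum_i `|x i 0| by exact: sumr_ge0.
    by apply: lerXn2r.
  rewrite ler_pdivlMr// exprMn.
  have C8 := @radius_const_ge R; have W2 : 0 < W ^+ 2 by rewrite exprn_gt0.
  have : W ^+ 2 * n%:R <= W ^+ 2 * q by rewrite ler_pM2l// ltW.
  have : 8 * (q * W ^+ 2) <= radius_const * (q * W ^+ 2).
    by rewrite ler_pM2r// mulr_gt0//; lra.
  have : 0 < q * W ^+ 2 by rewrite mulr_gt0//; lra.
  lra.
pose la (i : 'I_m) := sigma i.+1 `^ q / S.
apply: (entropy_radius hG n0 (K := ellipsoid p sigma m) (h := h) (la := la)) => //.
- exact: ltnW.
- by rewrite q1.
- by move=> i; rewrite divr_gt0// powR_gt0// s0.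
- by rewrite -mulr_suml divff// gt_eqF.
- by move=> c x; apply: ellipsoid_star => //; exact: ltW.
- by move=> x /tail[].
- by move=> x /tail[].
Qed.

Lemma radius_one : let M := \big[Num.max/0]_(h.+1 <= j < m.+1)
    (sigma j * Num.sqrt (ln j%:R + 1)) in
  exists Om : set T, [/\ measurable Om, ((1 - 2 * expR (- n%:R))%:E <= P Om)%E &
    forall w, Om w -> forall x, ellipsoid 1%E sigma m x -> gaussian_mx G w *m x = 0 ->
      sqn x <= 64 * radius_const * M ^+ 2 / n%:R].
Proof.
move=> M.
have sL (i : nat) : 0 < sigma i.+1 * Num.sqrt (ln i.+1%:R + 1).
  rewrite mulr_gt0 ?s0// sqrtr_gt0; exact: lt_le_trans ltr01 (log_weight_ge1 i).
have leM (i : 'I_m) : (h <= i)%N -> sigma i.+1 * Num.sqrt (ln i.+1%:R + 1) <= M.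
  move=> hi; apply: (@bigmax_sup_seq _ _ _ _ 0 i.+1) => //.
  by rewrite mem_index_iota ltnS hi ltnS ltn_ord.
have M0 : 0 < M by exact: lt_le_trans (sL h) (leM (Ordinal hm) (leqnn h)).
have sM (i : 'I_m) : (h <= i)%N -> sigma i.+1 ^+ 2 * log_weight i <= M ^+ 2.
  move=> hi; have L1 := @log_weight_ge1 R i.
  rewrite -[log_weight i]sqr_sqrtr; last by apply: le_trans L1.
  rewrite -exprMn; apply: lerXn2r; rewrite ?nnegrE ?(ltW M0) ?(ltW (sL i))//.
  exact: leM.
have [Om [mOm POm H]] := weighted_l1_radius hG n0 (ltnW hm)
  (fun i : 'I_m => s0 (isT : (1 <= i.+1)%N)) M0 sM hn.
exists Om; split => // w Omw x Kx; apply: (H w Omw x).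
move: Kx; rewrite /ellipsoid /= => Kx; apply: le_trans Kx; apply: ler_sum => i _.
by rewrite !powRr1// ltW// s0.
Qed.

Lemma radius_event (p : \bar R) (B c : R) : (1 <= p)%E -> 0 <= B -> c = B ^+ 2 ->
  (exists Om : set T, [/\ measurable Om, ((1 - 2 * expR (- n%:R))%:E <= P Om)%E &
    forall w, Om w -> forall x, ellipsoid p sigma m x -> gaussian_mx G w *m x = 0 ->
      sqn x <= c]) ->
  ((1 - 2 * expR (- n%:R))%:E <=
    P [set w | (section_rad (ellipsoid p sigma m) (ran_subspace G w) <= B%:E)%E])%E.
Proof.
move=> p1 B0 -> [Om [mOm POm OmP]].
have E : [set w | (section_rad (ellipsoid p sigma m) (ran_subspace G w) <= B%:E)%E] =
  [set w | forall x, ellipsoid p sigma m x -> gaussian_mx G w *m x = 0 -> sqn x <= B ^+ 2].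
  by apply/seteqP; split => w /= /(section_rad_le _ _ B0).
rewrite E; apply: (le_trans POm); apply: le_measure; rewrite ?inE//.
apply: (measurable_kernel_radius G (M := \sum_(i < m) sigma i.+1)).
- exact: sqr_ge0.
- move=> x Kx i; apply: (le_trans (ellipsoid_coord_le i p1 s0 Kx)).
  rewrite (bigD1 i)//= lerDl sumr_ge0// => j _; exact/ltW/s0.
- by move=> x y; exact: ellipsoid_solid.
Qed.

End Radius.

Theorem theorem3p4 (R : realType) :
  exists C c1 c2 c : R, [/\ 0 < C, 0 < c1, 0 < c2, 0 < c &
    forall p : \bar R, (1 <= p)%E ->
    exists (k : nat -> nat) (C' : R),
    [/\ 0 < C',
        (forall n, (1 <= n)%N -> (1 <= k n)%N),
        asymp_with c C' (fun n => (k n)%:R) (k_scale p) &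
        forall sigma : nat -> R,
          (forall j, (1 <= j)%N -> 0 < sigma j) ->
          (forall i j, (1 <= i <= j)%N -> sigma j <= sigma i) ->
        forall n m : nat, (1 <= n < m)%N ->
        forall (d : measure_display) (T : measurableType d)
          (P : probability T R) (G : 'I_n -> 'I_m -> {RV P >-> R}),
          std_gaussian_matrix G ->
          ((1 - c1 * expR (- (c2 * n%:R)))%:E <=
            P [set w | (section_rad (ellipsoid p sigma m) (ran_subspace G w) <=
                       (C * rad_bound p sigma n m (k n))%:E)%E])%E]].
Proof.
have C8 := @radius_const_ge R; set C0 : R := radius_const in C8.
have C00 : 0 < C0 by lra.
(* [16 * C0 * h <= n] is the head condition of [kernel_radius]. *)
pose kappa : R := (16 * C0)^-1.
have kappa0 : 0 < kappa by rewrite invr_gt0 mulr_gt0.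
have kappa1 : 16 * C0 * kappa = 1 by rewrite divff// gt_eqF// mulr_gt0.
exists (8 * Num.sqrt C0), 2, 1, kappa; split => //.
  by rewrite mulr_gt0// sqrtr_gt0.
move=> p p1.
pose q : R := if p == 1%E then 1 else conj_exp p.
have p1' : p != 1%E -> (1 < p)%E by move=> pn1; rewrite lt_neqAle eq_sym pn1.
have q1 : 1 <= q by rewrite /q; case: eqVneq => // /p1' /conj_exp_ge1.
have q0 : 0 < q by lra.
have scaleE n : k_scale p n = n%:R / q.
  by rewrite /k_scale /q; case: ifP => // _; rewrite divr1.
pose hd n := Num.truncn (kappa * n%:R / q).
have arg0 n : 0 <= kappa * n%:R / q by rewrite divr_ge0 ?mulr_ge0// ltW.
have hd_le n : (hd n)%:R <= kappa * n%:R / q by rewrite truncn_le.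
have hd_gt n : kappa * n%:R / q < (hd n).+1%:R by exact: truncnS_gt.
(* [k n <= kappa n / q + 1], and [1 <= q (n / q)]. *)
exists (fun n => (hd n).+1), (kappa + q); split => //.
- by rewrite addr_gt0.
- move=> n n1 /=; rewrite scaleE mulrA ltW//=.
  rewrite -natr1 [(kappa + q) * _]mulrDl mulrA; apply: lerD => //.
  by rewrite mulrCA divff ?gt_eqF// mulr1 ler1n.
move=> sigma s0 _ n m /andP[n0 nm] d T P G hG.
have nR : 0 < n%:R :> R by rewrite ltr0n.
have hn : 16 * C0 * (hd n)%:R <= n%:R.
  apply: (@le_trans _ _ (16 * C0 * (kappa * n%:R / q))).
    by rewrite ler_pM2l// mulr_gt0.
  by rewrite mulrA mulrA kappa1 mul1r ler_pdivrMr// ler_peMr// ltW.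
have hm : (hd n < m)%N.
  apply: leq_ltn_trans nm; rewrite -(ler_nat R); apply: le_trans hn.
  by rewrite ler_peMl//; lra.
rewrite mul1r.
have [pE|pn1] := eqVneq p 1%E.
  subst p; rewrite /rad_bound eqxx; set M := \big[_/_]_(_ <= _ < _) _.
  have M0 : 0 <= M by exact: bigmax_ge_id.
  apply: (radius_event (p := 1%E) s0 p1 _ _ (radius_one hG n0 s0 hm hn)).
    by rewrite mulr_ge0 ?mulr_ge0 ?sqrtr_ge0 ?powR_ge0.
  rewrite -/M -/C0 !exprMn sqr_sqrtr ?(ltW C00)// sqr_powR_Nhalf//; ring.
have qE : conj_exp p = q by rewrite /q (negbTE pn1).
have h0 : n%:R < conj_exp p -> hd n = 0%N.
  rewrite qE => nq; apply/eqP; rewrite -leqn0 -ltnS -(ltr_nat R).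
  apply: (le_lt_trans (hd_le n)); rewrite ltr_pdivrMr// mul1r.
  apply: lt_trans nq; rewrite gtr_pMl//.
  by rewrite invf_lt1 ?mulr_gt0//; lra.
apply: (radius_event s0 p1 _ _ (radius_conj hG n0 s0 hm hn (p1' pn1) h0)).
  by rewrite /rad_bound (negbTE pn1) !mulr_ge0 ?sqrtr_ge0 ?powR_ge0.
rewrite /rad_bound (negbTE pn1) big_nat_tail qE -/C0.
by rewrite !exprMn !sqr_sqrtr ?(ltW C00) ?(ltW q0)// sqr_powR_Nhalf//; ring.
Qed.
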